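(* Let $K$ be an infinite field, $E=K\langle e_1,\dots,e_n\rangle$ the exterior algebra, and let $J\subset E$ be a graded ideal such that $E/J$ has a $d$-linear injective resolution. Then $$\operatorname{reg}E/J+\operatorname{depth}E/J=d.$$
   Context: $E$ is standard graded with $\deg e_i=1$. A graded $E$-module $M$ has a $d$-linear injective resolution if its minimal graded injective resolution has the form $0\to E(n-d)^{\mu_0}\to E(n-d+1)^{\mu_1}\to E(n-d+2)^{\mu_2}\to\cdots$. For $M\neq0$, $\operatorname{reg}M=\max\{j-i: \operatorname{Tor}^E_i(K,M)_j\neq0\}$. An element $v\in E_1$ is $M$-regular if $0:_Mv=vM$; a sequence $v_1,\dots,v_s\in E_1$ is $M$-regular if $v_i$ is $M/(v_1,\dots,v_{i-1})M$-regular for each $i$ and $M/(v_1,\dots,v_s)M\neq0$; $\operatorname{depth}M$ is the common length of all maximal $M$-regular sequences. *)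

(* Defs.v *)
From HB Require Import structures.
From mathcomp Require Import all_boot all_order all_algebra.
From mathcomp Require Import ring zify.
From mathcomp Require Import boolp classical_sets cardinality.

Set Implicit Arguments.
Unset Strict Implicit.
Unset Printing Implicit Defensive.

Import GRing.Theory Num.Theory.
Local Open Scope ring_scope.
Local Open Scope quotient_scope.

Section Modules.
Variable R : nzRingType.
Implicit Type M : lmodType R.

Section Generated.
Variables (M : lmodType R) (A : set M).

Definition gensub : {pred M} :=
  fun x => `[< forall N : submodClosed M, (forall y, A y -> y \in N) -> x \in N >].

Fact gensub_closed : submod_closed gensub.
Proof.
split=> [|a x y /asboolP Hx /asboolP Hy]; apply/asboolP => N HN.
  exact: rpred0.
by rewrite rpredD ?rpredZ ?Hx ?Hy.
Qed.
HB.instance Definition _ := GRing.isSubmodClosed.Build R M gensub gensub_closed.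

End Generated.

Section PropSubmodule.
Variables (M : lmodType R) (P : M -> Prop).

Definition submod_prop := P 0 /\ forall a x y, P x -> P y -> P (a *: x + y).

Definition propsub of submod_prop : {pred M} := fun x => `[< P x >].

Fact propsub_closed HP : submod_closed (propsub HP).
Proof.
case: HP => P0 PD; split=> [|a x y /asboolP Px /asboolP Py]; apply/asboolP => //.
exact: PD.
Qed.
HB.instance Definition _ HP :=
  GRing.isSubmodClosed.Build R M (propsub HP) (propsub_closed HP).

Lemma gensub_ind (A : set M) x :
  submod_prop -> (forall y, A y -> P y) -> x \in gensub A -> P x.
Proof.
move=> HP AP /asboolP Hx; apply/asboolP; apply: (Hx (propsub HP)) => y Ay.
exact/asboolP/AP.
Qed.

End PropSubmodule.

Lemma gensub_sub M (A : set M) x : A x -> x \in gensub A.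
Proof. by move=> Ax; apply/asboolP => N; apply. Qed.

(* (v_1, ..., v_s)M, generated as a submodule by the products v_k x. *)
Definition idealmul (vs : seq R) M : submodClosed M :=
  gensub [set y : M | exists v x, v \in vs /\ y = v *: x].

Section Quotient.
Variables (M : lmodType R) (N : submodClosed M).

(* MathComp does not derive closure under opposite from submodClosed. *)
Definition zsub : {pred M} := fun x => x \in N.

Fact zsub_closed : zmod_closed zsub.
Proof.
split=> [|x y Hx Hy]; first exact: (rpred0 N).
by rewrite /zsub unfold_in /= rpredD // -scaleN1r rpredZ.
Qed.
HB.instance Definition _ := GRing.isZmodClosed.Build M zsub zsub_closed.

Definition quotmod := Quotient.quot zsub.
HB.instance Definition _ := GRing.Zmodule.on quotmod.

Definition qproj (x : M) : quotmod := \pi_(Quotient.quot zsub) x.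

Lemma qprojE x y : (qproj x = qproj y) <-> (x - y \in N).
Proof.
split=> [/eqP|Hxy]; first by rewrite -Quotient.idealrBE.
by apply/eqP; rewrite -Quotient.idealrBE.
Qed.

Lemma qprojP (x : quotmod) : qproj (repr x) = x.
Proof. exact: reprK. Qed.

Fact qproj_is_zmod_morphism : zmod_morphism qproj.
Proof. exact: (raddfB (\pi_(Quotient.quot zsub))). Qed.
HB.instance Definition _ :=
  GRing.isZmodMorphism.Build M quotmod qproj qproj_is_zmod_morphism.

Definition qscale (a : R) (x : quotmod) : quotmod := qproj (a *: repr x).

Lemma qscaleE a x : qscale a (qproj x) = qproj (a *: x).
Proof. by apply/qprojE; rewrite -scalerBr rpredZ //; apply/qprojE/qprojP. Qed.

Fact qscaleA a b x : qscale a (qscale b x) = qscale (a * b) x.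
Proof. by rewrite -(qprojP x) !qscaleE scalerA. Qed.
Fact qscale1 : left_id 1 qscale.
Proof. by move=> x; rewrite -(qprojP x) qscaleE scale1r. Qed.
Fact qscaleDr : right_distributive qscale +%R.
Proof.
move=> a x y; rewrite -(qprojP x) -(qprojP y).
by rewrite -raddfD !qscaleE scalerDr raddfD.
Qed.
Fact qscaleDl x : {morph qscale^~ x : a b / a + b}.
Proof. by move=> a b; rewrite -(qprojP x) !qscaleE scalerDl raddfD. Qed.
HB.instance Definition _ :=
  GRing.Zmodule_isLmodule.Build R quotmod qscaleA qscale1 qscaleDr qscaleDl.

Fact qproj_is_scalable : scalable qproj.
Proof. by move=> a x; rewrite -qscaleE. Qed.
HB.instance Definition _ :=
  GRing.isScalable.Build R M quotmod *:%R qproj qproj_is_scalable.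

End Quotient.

Definition exact_at (M N P : lmodType R) (f : M -> N) (g : N -> P) :=
  forall y, g y = 0 <-> exists x, f x = y.

End Modules.

(* The exterior algebra on e_0, ..., e_(n-1); x A is the coefficient in x of
   the monomial e_A, the increasing product of the e_i with i in A. *)
Section Exterior.
Variables (K : fieldType) (n : nat).

Definition extalg := {ffun {set 'I_n} -> K^o}.
HB.instance Definition _ := GRing.Lmodule.on extalg.

Definition inversions (A B : {set 'I_n}) : nat :=
  \sum_(i in A) \sum_(j in B) (j < i)%N.

(* e_A e_B = extsign A B *: e_(A :|: B) *)
Definition extsign (A B : {set 'I_n}) : K :=
  if [disjoint A & B] then (-1) ^+ inversions A B else 0.

Definition extmul (x y : extalg) : extalg :=
  [ffun C => \sum_A \sum_(B | A :|: B == C) extsign A B * x A * y B].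

Definition extmon (C : {set 'I_n}) : extalg := [ffun A => (A == C)%:R].

Definition extgen (i : 'I_n) : extalg := extmon [set i].

Implicit Types A B C D : {set 'I_n}.

Lemma inversionsUl A B C : [disjoint A & B] ->
  inversions (A :|: B) C = (inversions A C + inversions B C)%N.
Proof.
move=> AB; rewrite /inversions -bigU //=.
by apply: eq_bigl => i; rewrite !inE.
Qed.

Lemma inversionsUr A B C : [disjoint B & C] ->
  inversions A (B :|: C) = (inversions A B + inversions A C)%N.
Proof.
move=> BC; rewrite /inversions -big_split /=; apply: eq_bigr => i _.
by rewrite -bigU //=; apply: eq_bigl => j; rewrite !inE.
Qed.

Lemma extsignA A B C :
  extsign A B * extsign (A :|: B) C = extsign B C * extsign A (B :|: C).
Proof.
have dUl : [disjoint A :|: B & C] = [disjoint A & C] && [disjoint B & C].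
  by rewrite -!finset.setI_eq0 finset.setIUl finset.setU_eq0.
have dUr : [disjoint A & B :|: C] = [disjoint A & B] && [disjoint A & C].
  by rewrite -!finset.setI_eq0 finset.setIUr finset.setU_eq0.
rewrite /extsign dUl dUr.
case AB: [disjoint A & B]; case AC: [disjoint A & C]; case BC: [disjoint B & C];
  rewrite ?mul0r ?mulr0 //=.
by rewrite -!exprD inversionsUl ?inversionsUr //; congr (_ ^+ _); lia.
Qed.

Lemma extsign0l A : extsign finset.set0 A = 1.
Proof. by rewrite /extsign -finset.setI_eq0 finset.set0I eqxx /inversions finset.big_set0. Qed.

Lemma extsign0r A : extsign A finset.set0 = 1.
Proof.
rewrite /extsign -finset.setI_eq0 finset.setI0 eqxx /inversions.
by rewrite big1 // => i _; rewrite finset.big_set0.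
Qed.

(* Collapses the intermediate index P = A :|: B. *)
Lemma sum_setU_collapse (Q : pred {set 'I_n}) B C (F : {set 'I_n} -> K) :
  \sum_(P | Q P && (B :|: C == P)) F P = if Q (B :|: C) then F (B :|: C) else 0.
Proof.
rewrite big_mkcond (bigD1 (B :|: C)) //=.
rewrite eqxx andbT big1 ?addr0 // => P; rewrite eq_sym => /negPf ->.
by rewrite andbF.
Qed.

Fact extmulA : associative extmul.
Proof.
move=> x y z; apply/ffunP => D; rewrite !ffunE.
transitivity (\sum_A \sum_B \sum_(C | A :|: (B :|: C) == D)
    extsign A (B :|: C) * extsign B C * x A * y B * z C).
  apply: eq_bigr => A _.
  transitivity (\sum_(P | A :|: P == D) \sum_B \sum_(C | B :|: C == P)
      extsign A P * extsign B C * x A * y B * z C).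
    apply: eq_bigr => P _; rewrite ffunE mulr_sumr; apply: eq_bigr => B _.
    by rewrite mulr_sumr; apply: eq_bigr => C _; ring.
  rewrite exchange_big; apply: eq_bigr => B _ /=.
  rewrite (exchange_big_dep predT) //= [RHS]big_mkcond; apply: eq_bigr => C _.
  exact: (@sum_setU_collapse (fun P => A :|: P == D)
    B C (fun P => extsign A P * extsign B C * x A * y B * z C)).
transitivity (\sum_P \sum_(C | P :|: C == D) \sum_A \sum_(B | A :|: B == P)
    extsign A B * extsign P C * x A * y B * z C).
  transitivity (\sum_A \sum_B \sum_(P | A :|: B == P) \sum_(C | P :|: C == D)
      extsign A B * extsign P C * x A * y B * z C).
    apply: eq_bigr => A _; apply: eq_bigr => B _.
    rewrite [RHS](big_pred1 (A :|: B)) => [|P]; last exact: eq_sym.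
    apply: eq_big => [C|C _]; first by rewrite finset.setUA.
    by rewrite extsignA [extsign B C * _]mulrC.
  transitivity (\sum_A \sum_P \sum_(B | A :|: B == P) \sum_(C | P :|: C == D)
      extsign A B * extsign P C * x A * y B * z C).
    by apply: eq_bigr => A _; rewrite [RHS](exchange_big_dep predT).
  rewrite exchange_big; apply: eq_bigr => P _ /=.
  rewrite [RHS]exchange_big; apply: eq_bigr => A _ /=.
  by rewrite exchange_big.
apply: eq_bigr => P _; apply: eq_bigr => C _; rewrite ffunE mulr_sumr mulr_suml.
apply: eq_bigr => A _; rewrite mulr_sumr mulr_suml; apply: eq_bigr => B _; ring.
Qed.

Fact extmul1l : left_id (extmon finset.set0) extmul.
Proof.
move=> x; apply/ffunP => C; rewrite ffunE (bigD1 finset.set0) //= [X in _ + X]big1 => [|A A0].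
  rewrite addr0 (big_pred1 C) => [|B]; last by rewrite finset.set0U.
  by rewrite ffunE eqxx extsign0l !mul1r.
by apply: big1 => B _; rewrite ffunE (negPf A0) mulr0 mul0r.
Qed.

Fact extmul1r : right_id (extmon finset.set0) extmul.
Proof.
move=> x; apply/ffunP => C; rewrite ffunE.
transitivity (\sum_(A | A == C) x A); last by rewrite big_pred1_eq.
rewrite [RHS]big_mkcond; apply: eq_bigr => A _.
rewrite big_mkcond (bigD1 finset.set0) //= [X in _ + X]big1 => [|B B0].
  rewrite addr0 finset.setU0; case: eqP => // _.
  by rewrite ffunE eqxx extsign0r mul1r mulr1.
by case: ifP => // _; rewrite ffunE (negPf B0) mulr0.
Qed.

Fact extmulDl : left_distributive extmul +%R.
Proof.
move=> x y z; apply/ffunP => C; rewrite !ffunE -big_split; apply: eq_bigr => A _ /=.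
by rewrite -big_split; apply: eq_bigr => B _ /=; rewrite ffunE /=; ring.
Qed.

Fact extmulDr : right_distributive extmul +%R.
Proof.
move=> x y z; apply/ffunP => C; rewrite !ffunE -big_split; apply: eq_bigr => A _ /=.
by rewrite -big_split; apply: eq_bigr => B _ /=; rewrite ffunE /=; ring.
Qed.

Fact extmon0_neq0 : extmon finset.set0 != 0.
Proof. by apply/eqP => /ffunP/(_ finset.set0)/eqP; rewrite !ffunE eqxx oner_eq0. Qed.

HB.instance Definition _ := GRing.Zmodule_isNzRing.Build extalg
  extmulA extmul1l extmul1r extmulDl extmulDr extmon0_neq0.

Fact extscaleAl (k : K) (x y : extalg) : k *: (x * y) = k *: x * y.
Proof.
apply/ffunP => C; rewrite !ffunE scaler_sumr; apply: eq_bigr => A _.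
by rewrite scaler_sumr; apply: eq_bigr => B _; rewrite ffunE /GRing.scale /=; ring.
Qed.
HB.instance Definition _ := GRing.Lmodule_isLalgebra.Build K extalg extscaleAl.

Fact extscaleAr (k : K) (x y : extalg) : k *: (x * y) = x * (k *: y).
Proof.
apply/ffunP => C; rewrite !ffunE scaler_sumr; apply: eq_bigr => A _.
by rewrite scaler_sumr; apply: eq_bigr => B _; rewrite ffunE /GRing.scale /=; ring.
Qed.
HB.instance Definition _ := GRing.Lalgebra_isAlgebra.Build K extalg extscaleAr.

Lemma extmonM A B : extmon A * extmon B = extsign A B *: extmon (A :|: B).
Proof.
apply/ffunP => C; rewrite !ffunE (bigD1 A) //= [X in _ + X]big1 => [|A' A'A]; last first.
  by rewrite big1 // => B' _; rewrite ffunE (negPf A'A) mulr0 mul0r.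
rewrite addr0 big_mkcond (bigD1 B) //= [X in _ + X]big1 => [|B' B'B]; last first.
  by case: ifP => // _; rewrite !ffunE (negPf B'B) mulr0.
by rewrite addr0 !ffunE !eqxx !mulr1 [C == _]eq_sym /GRing.scale /=; case: eqP;
  rewrite ?mulr1 ?mulr0.
Qed.

Lemma extgen_sqr i : extgen i * extgen i = 0.
Proof.
by rewrite extmonM /extsign -finset.setI_eq0 finset.setIid -cards_eq0 cards1 scale0r.
Qed.

Lemma extgen_anticomm i j : extgen i * extgen j = - (extgen j * extgen i).
Proof.
have [->|ij] := eqVneq i j; first by rewrite extgen_sqr oppr0.
rewrite !extmonM finset.setUC -scaleNr; congr (_ *: _).
rewrite /extsign ![[disjoint finset.set1 _ & _]]disjoints1 !finset.in_set1.
rewrite [j == i]eq_sym (negPf ij) /inversions !finset.big_set1.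
by case: (ltngtP i j) ij => [||/val_inj->]; rewrite ?eqxx ?expr0 ?expr1 ?opprK.
Qed.


(* The component of degree j; it vanishes unless 0 <= j <= n. *)
Definition extcomp (j : int) (x : extalg) : extalg :=
  [ffun A : {set 'I_n} => if #|A|%:Z == j then x A else 0].

Lemma extcompD j : {morph extcomp j : x y / x + y}.
Proof.
by move=> x y; apply/ffunP => A; rewrite !ffunE; case: ifP; rewrite ?addr0.
Qed.

Lemma extcomp_comp i j x :
  extcomp i (extcomp j x) = if i == j then extcomp j x else 0.
Proof.
apply/ffunP => A; rewrite ffunE; have [<-|Ai] := eqVneq _ i.
  by case: eqP => // /eqP/negPf HA; rewrite !ffunE HA.
have [ij|_] := eqVneq i j; last by rewrite ffunE.
by rewrite ffunE -ij (negPf Ai).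
Qed.

Lemma extcomp_sum x : x = \sum_(j <- [seq i%:Z | i <- iota 0 n.+1]) extcomp j x.
Proof.
apply/ffunP => A; rewrite sum_ffunE.
have Hu : uniq [seq i%:Z | i <- iota 0 n.+1].
  by rewrite map_inj_uniq ?iota_uniq // => i j [].
have HA : #|A|%:Z \in [seq i%:Z | i <- iota 0 n.+1].
  rewrite mem_map ?mem_iota ?add0n ?ltnS => [|i j []] //.
  by rewrite (leq_trans (max_card _)) ?card_ord.
rewrite (bigD1_seq _ HA Hu) /= ffunE eqxx big1 ?addr0 // => i Ai.
by rewrite ffunE eq_sym (negPf Ai).
Qed.

Lemma extcompM i j x y :
  extcomp (i + j) (extcomp i x * y) = extcomp i x * extcomp j y.
Proof.
apply/ffunP => C; rewrite !ffunE.
have -> : (if #|C|%:Z == i + j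
           then \sum_A \sum_(B | A :|: B == C) extsign A B * extcomp i x A * y B
           else 0) =
          \sum_A \sum_(B | A :|: B == C)
            if #|C|%:Z == i + j then extsign A B * extcomp i x A * y B else 0.
  by case: ifP => // _; rewrite big1 // => A _; rewrite big1.
apply: eq_bigr => A _; apply: eq_bigr => B /eqP <-; rewrite !ffunE /extsign.
case: (boolP [disjoint A & B]) => [AB|_]; last by rewrite !mul0r if_same.
have := finset.cardsUI A B; move: AB; rewrite -finset.setI_eq0 => /eqP ->.
rewrite finset.cards0 addn0 => ->; case: (eqVneq #|A|%:Z i) => [<-|_].
  by rewrite PoszD (inj_eq (addrI _)); case: eqP; rewrite ?mulr0.
by rewrite mulr0 !mul0r if_same.
Qed.

End Exterior.

(* A graded left module determines a graded bimodule by
   x a = (-1)^(deg a deg x) a x for homogeneous a and x. *)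
Section Graded.
Variables (K : fieldType) (n : nat).
Local Notation E := (extalg K n).

(* The grading is given by its homogeneous components: M_j is the image of the
   projection gcomp j. *)
Record gmod := GMod {
  gcarrier :> lmodType E;
  gcomp : int -> gcarrier -> gcarrier;
  gcompD : forall j, {morph gcomp j : x y / x + y};
  gcomp_comp : forall i j x,
    gcomp i (gcomp j x) = if i == j then gcomp j x else 0;
  gcomp_sum : forall x, exists2 s : seq int, uniq s & x = \sum_(j <- s) gcomp j x;
  gcompZ : forall i j (a : E) x,
    gcomp (i + j) (extcomp i a *: x) = extcomp i a *: gcomp j x
}.

Definition homog (M : gmod) (j : int) (x : M) := gcomp j x = x.

Definition degree0 (M N : gmod) (f : M -> N) :=
  forall j x, homog j x -> homog j (f x).

Definition graded_submod (M : gmod) (N : submodClosed M) :=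
  forall j x, x \in N -> gcomp j x \in N.

Section Basics.
Variable M : gmod.

Lemma gcomp0 j : gcomp j (0 : M) = 0.
Proof. by apply: (addrI (gcomp j 0)); rewrite -gcompD !addr0. Qed.

Lemma gcompN j : {morph @gcomp M j : x / - x}.
Proof. by move=> x; apply: (addrI (gcomp j x)); rewrite -gcompD !subrr gcomp0. Qed.

Lemma gcompB j : {morph @gcomp M j : x y / x - y}.
Proof. by move=> x y; rewrite gcompD gcompN. Qed.

Lemma gcomp_bigsum j I (r : seq I) (F : I -> M) :
  gcomp j (\sum_(i <- r) F i) = \sum_(i <- r) gcomp j (F i).
Proof. exact: (big_morph _ (@gcompD M j) (gcomp0 j)). Qed.

Lemma gcompZ_sum j (a : E) (x : M) :
  gcomp j (a *: x) =
  \sum_(i <- [seq k%:Z | k <- iota 0 n.+1]) extcomp i a *: gcomp (j - i) x.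
Proof.
rewrite {1}[a]extcomp_sum scaler_suml gcomp_bigsum; apply: eq_bigr => i _.
by rewrite -gcompZ addrC subrK.
Qed.

End Basics.

Fact gself_sum (x : E^o) :
  exists2 s : seq int, uniq s & x = \sum_(j <- s) extcomp j x.
Proof.
exists [seq i%:Z | i <- iota 0 n.+1]; last exact: extcomp_sum.
by rewrite map_inj_uniq ?iota_uniq // => i j [].
Qed.

Definition gself : gmod :=
  @GMod E^o (@extcomp K n) (@extcompD K n) (@extcomp_comp K n) gself_sum
    (@extcompM K n).

(* The direct sum of the E(a) for a in s, where E(a)_j = E_(a + j). *)
Section Free.
Variable s : seq int.

Definition freecomp (j : int) (x : 'rV[E]_(size s)) : 'rV[E]_(size s) :=
  \row_k extcomp (s`_k + j) (x 0 k).

Fact freecompD j : {morph freecomp j : x y / x + y}.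
Proof. by move=> x y; apply/rowP => k; rewrite !mxE extcompD. Qed.

Fact freecomp_comp i j x :
  freecomp i (freecomp j x) = if i == j then freecomp j x else 0.
Proof.
apply/rowP => k; rewrite !mxE extcomp_comp (inj_eq (addrI _)).
by case: ifP => _; rewrite mxE.
Qed.

Fact freecomp_sum (x : 'rV[E]_(size s)) :
  exists2 t : seq int, uniq t & x = \sum_(j <- t) freecomp j x.
Proof.
pose t := undup [seq i%:Z - a | i <- iota 0 n.+1, a <- s].
exists t; first exact: undup_uniq.
apply/rowP => k; rewrite summxE; apply/ffunP => A; rewrite sum_ffunE.
have HA : #|A|%:Z - s`_k \in t.
  rewrite mem_undup; apply: (allpairs_f (fun (i : nat) a => i%:Z - a)).
    by rewrite mem_iota add0n ltnS (leq_trans (max_card _)) ?card_ord.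
  exact: mem_nth.
rewrite (bigD1_seq _ HA (undup_uniq _)) /= !mxE ffunE [s`_k + _]addrC subrK eqxx.
rewrite big1 ?addr0 // => j; rewrite mxE ffunE eq_sym subr_eq addrC => /negPf.
by rewrite eq_sym => ->.
Qed.

Fact freecompZ i j (a : E) x :
  freecomp (i + j) (extcomp i a *: x) = extcomp i a *: freecomp j x.
Proof. by apply/rowP => k; rewrite !mxE addrCA extcompM. Qed.

Definition gfree : gmod :=
  @GMod 'rV[E]_(size s) freecomp freecompD freecomp_comp freecomp_sum freecompZ.

End Free.

Section GradedQuotient.
Variables (M : gmod) (N : submodClosed M) (HN : graded_submod N).

Definition quotcomp (j : int) (x : quotmod N) : quotmod N :=
  qproj N (gcomp j (repr x)).

Lemma quotcompE j x : quotcomp j (qproj N x) = qproj N (gcomp j x).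
Proof. by apply/qprojE; rewrite -gcompB HN //; apply/qprojE/qprojP. Qed.

Fact quotcompD j : {morph quotcomp j : x y / x + y}.
Proof.
move=> x y; rewrite -(qprojP x) -(qprojP y) -raddfD !quotcompE.
by rewrite gcompD raddfD.
Qed.

Fact quotcomp_comp i j x :
  quotcomp i (quotcomp j x) = if i == j then quotcomp j x else 0.
Proof.
rewrite -(qprojP x) !quotcompE gcomp_comp.
by case: ifP => // _; rewrite raddf0.
Qed.

Fact quotcomp_sum x :
  exists2 s : seq int, uniq s & x = \sum_(j <- s) quotcomp j x.
Proof.
have [s Hs xE] := gcomp_sum (repr x); exists s => //.
by rewrite -{1}(qprojP x) xE raddf_sum.
Qed.

Fact quotcompZ i j (a : E) x :
  quotcomp (i + j) (extcomp i a *: x) = extcomp i a *: quotcomp j x.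
Proof. by rewrite -(qprojP x) -linearZ !quotcompE gcompZ linearZ. Qed.

Definition gquot : gmod :=
  @GMod (quotmod N) quotcomp quotcompD quotcomp_comp quotcomp_sum quotcompZ.

End GradedQuotient.

Definition graded_ideal (J : submodClosed E^o) :=
  @graded_submod gself J /\ forall x a : E, x \in J -> x * a \in J.

Definition idealquot (J : submodClosed E^o) (HJ : graded_ideal J) : gmod :=
  gquot (proj1 HJ).

Definition extgens : seq E := [seq extgen K i | i <- enum 'I_n].

Lemma extcomp_extgen (i : 'I_n) : extcomp 1 (extgen K i) = extgen K i.
Proof.
by apply/ffunP => A; rewrite !ffunE; have [->|] := eqVneq A; rewrite ?cards1 ?if_same.
Qed.

Fact idealmul_extgens_graded (M : gmod) : graded_submod (idealmul extgens M).
Proof.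
move=> j x Hx; move: j; elim/gensub_ind: Hx => [|_ [_ [y [/mapP[i _ ->] ->]]] j].
  split=> [j|a y z Hy Hz j]; first by rewrite gcomp0 rpred0.
  by rewrite gcompD gcompZ_sum rpredD // rpred_sum // => i _; rewrite rpredZ.
rewrite -extcomp_extgen -[j](subrK 1) addrC gcompZ extcomp_extgen.
by apply: gensub_sub; exists (extgen K i), (gcomp (j - 1) y); rewrite map_f ?mem_enum.
Qed.

(* K = E/(e_1, ..., e_n), so the tensor product of K with M over E is
   M/(e_1, ..., e_n)M. *)
Definition Ktensor (M : gmod) : gmod := gquot (@idealmul_extgens_graded M).

Definition Ktensor_map (M N : gmod) (f : M -> N) (x : Ktensor M) : Ktensor N :=
  qproj (idealmul extgens N) (f (repr x)).

Lemma Ktensor_mapE (M N : gmod) (f : {linear M -> N}) x :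
  Ktensor_map f (qproj (idealmul extgens M) x) = qproj (idealmul extgens N) (f x).
Proof.
apply/qprojE; rewrite -linearB.
have : repr (qproj (idealmul extgens M) x) - x \in idealmul extgens M.
  exact/qprojE/qprojP.
elim/gensub_ind => [|_ [v [y [Hv ->]]]].
  split=> [|a y z Hy Hz]; first by rewrite linear0 rpred0.
  by rewrite linearP rpredD ?rpredZ.
by rewrite linearZ; apply: gensub_sub; exists v, (f y).
Qed.

(* Graded resolutions by free modules of finite rank: these exist for finitely
   generated M, which is the case of interest. *)
Record free_resolution (M : gmod) := FreeResolution {
  fr_shift : nat -> seq int;
  fr_aug : {linear gfree (fr_shift 0) -> M};
  fr_diff : forall i, {linear gfree (fr_shift i.+1) -> gfree (fr_shift i)};
  fr_aug_degree0 : degree0 fr_aug;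
  fr_diff_degree0 : forall i, degree0 (fr_diff i);
  fr_aug_surj : forall y, exists x, fr_aug x = y;
  fr_exact0 : exact_at (fr_diff 0) fr_aug;
  fr_exact : forall i, exact_at (fr_diff i.+1) (fr_diff i)
}.

(* Tor_i(K, M)_j, the degree j part of the i-th homology of the tensor product
   of K with F. *)
Definition Tor_cycle M (F : free_resolution M) (i : nat) :
    Ktensor (gfree (fr_shift F i)) -> Prop :=
  match i with
  | 0 => fun=> True
  | k.+1 => fun z => Ktensor_map (fr_diff F k) z = 0
  end.

Definition Tor_neq0 M (F : free_resolution M) (i : nat) (j : int) :=
  exists z : Ktensor (gfree (fr_shift F i)),
    [/\ homog j z, Tor_cycle z & ~ exists w, Ktensor_map (fr_diff F i) w = z].

(* By the comparison theorem Tor does not depend on the resolution F. *)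
Definition is_reg (M : gmod) (r : int) :=
  exists F : free_resolution M,
    (exists i j, Tor_neq0 F i j /\ j - i%:Z = r) /\
    (forall i j, Tor_neq0 F i j -> j - i%:Z <= r).

Definition graded_injective (I : gmod) :=
  forall (A B : gmod) (f : {linear A -> B}) (g : {linear A -> I}),
    degree0 f -> degree0 g -> injective f ->
    exists2 h : {linear B -> I}, degree0 h & forall x, h (f x) = g x.

Definition graded_essential (M : gmod) (P : M -> Prop) :=
  forall N : submodClosed M, graded_submod N ->
    (exists2 x, x \in N & x != 0) -> exists x, [/\ x \in N, x != 0 & P x].

(* Minimality: each I i is an essential extension of the kernel of the
   differential, i.e. an injective hull of it. *)
Record min_inj_resolution (M : gmod) (I : nat -> gmod) := MinInjResolution {
  ir_aug : {linear M -> I 0};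
  ir_diff : forall i, {linear I i -> I i.+1};
  ir_injective : forall i, graded_injective (I i);
  ir_aug_degree0 : degree0 ir_aug;
  ir_diff_degree0 : forall i, degree0 (ir_diff i);
  ir_aug_inj : injective ir_aug;
  ir_exact0 : exact_at ir_aug (ir_diff 0);
  ir_exact : forall i, exact_at (ir_diff i) (ir_diff i.+1);
  ir_minimal : forall i, graded_essential (fun x : I i => ir_diff i x = 0)
}.

Definition linear_inj_resolution (M : gmod) (d : int) :=
  exists mu : nat -> nat,
    inhabited (min_inj_resolution M
      (fun i => gfree (nseq (mu i) (n%:Z - d + i%:Z)))).

Definition regular_elt (M : lmodType E) (v : E) :=
  forall x : M, v *: x = 0 <-> exists y, x = v *: y.

Definition regular_seq (M : lmodType E) (vs : seq E) :=
  [/\ forall v, v \in vs -> extcomp 1 v = v,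
      forall k, (k < size vs)%N ->
        regular_elt (quotmod (idealmul (take k vs) M)) vs`_k
    & exists x : quotmod (idealmul vs M), x != 0].

Definition max_regular_seq (M : lmodType E) (vs : seq E) :=
  regular_seq M vs /\ forall v, ~ regular_seq M (rcons vs v).

Definition is_depth (M : lmodType E) (t : nat) :=
  (exists vs, max_regular_seq M vs) /\
  (forall vs, max_regular_seq M vs -> size vs = t).

End Graded.

(* Main.v *)
(* Write M = E/J and let D and S be the divided power and symmetric algebras in
   n variables.  The Cartan complexes M (x) D and M (x) S, with the differential
   given by multiplication by the sum of the x_k (x) e_k, compute Tor^E(K, M) and
   Ext_E(K, M).  A d-linear injective resolution gives M_j = 0 for j > d and
   exactness of M (x) S in all M-degrees j < d.
   If v is regular on M, the sequence 0 -> M/vM -> M -> M/vM -> 0 shows that the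
   second property passes to M/vM with d - 1 in place of d, and that M (x) D is
   exact in M-degree j if and only if (M/vM) (x) D is.  Hence reg M <= d - t for
   every regular sequence of length t.
   If Tor vanishes in M-degree d - t, replace M by its quotient M' by the sequence,
   with top degree d' = d - t.  By duality the matrix over S of
   M'_(d'-1) (x) S -> M'_d' (x) S has full rank over Frac S, so some q != 0 in S
   kills the cokernel.  By exactness in the lower degrees there is an S-linear
   homotopy between q and 0; evaluating it at a point c of K^n with q(c) != 0
   shows that v = sum c_k e_k is regular on M'.  So reg M = d - t for every
   maximal regular sequence. *)
From mathcomp Require Import mpoly.
Require Import Defs.
From HB Require Import structures.
From mathcomp Require Import all_boot all_order all_algebra.
From mathcomp Require Import ring zify.
From mathcomp Require Import boolp classical_sets cardinality.

Set Implicit Arguments.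
Unset Strict Implicit.
Unset Printing Implicit Defensive.

Import Order.TTheory GRing.Theory Num.Theory.
Local Open Scope ring_scope.

(* homog itself is a keyword of mpoly. *)
Notation homogeneous := Defs.homog.

(** * The exterior algebra and the Cartan complexes *)

(** In these complexes Tor_i(K, M)_(i+j) is homology of M-degree j, so reg M is the largest M-degree
    with nonzero homology of M (x) D. The delicate direction is from M/vM back to M. In the long
    exact sequence, homology of M/vM in M-degree j - 1 maps to that of M in M-degree j, and for j =
    d - t + 1 nothing is known about the source. The map itself has to be shown to be zero: v u is a
    boundary for every cycle u. The preimage is built by recursion on the exponent of the variable
    dual to v, which makes sense only if v belongs to the basis of E_1 that defines the complex.
    Therefore the complexes are formed for an arbitrary basis w of E_1, and Tor is computed from
    each of them. A regular sequence does extend to a basis: the class of 1 survives in every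
    quotient by elements of degree 1, which forces linear independence. The common length of maximal
    regular sequences is obtained, not assumed: reg M does not depend on the sequence, and it equals
    d - t for each of them. *)

Lemma sum_alternating (V : zmodType) (n : nat) (F : 'I_n -> 'I_n -> V) :
  (forall k, F k k = 0) -> (forall k l, F k l = - F l k) ->
  \sum_k \sum_l F k l = 0.
Proof.
move=> F0 FN.
rewrite (eq_bigr (fun k : 'I_n => \sum_(l : 'I_n | (l < k)%N) F k l +
    \sum_(l : 'I_n | (k < l)%N) F k l)).
  rewrite big_split /= [X in _ + X](exchange_big_dep predT) //= -big_split big1 // => k _.
  by rewrite -big_split big1 // => l _ /=; rewrite [F l k]FN subrr.
move=> k _; rewrite (bigID (fun l : 'I_n => (l < k)%N)) /=; congr (_ + _).
rewrite (bigD1 k) ?ltnn //= F0 add0r; apply: eq_bigl => l.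
by rewrite -leqNgt [RHS]ltn_neqAle andbC eq_sym.
Qed.

Section Contraction.
Variables (K : fieldType) (n : nat).
Local Notation E := (extalg K n).
Implicit Types (x y : E) (A C : {set 'I_n}) (k l : 'I_n).

Lemma extgen_mulE k x C :
  (extgen K k * x) C =
  if k \in C then extsign K [set k]%SET (C :\ k)%SET * x (C :\ k)%SET else 0.
Proof.
rewrite [LHS]ffunE (bigD1 [set k]%SET) //= [X in _ + X]big1 => [|A Ak]; last first.
  by rewrite big1 // => B _; rewrite ffunE (negPf Ak) mulr0 mul0r.
rewrite addr0 ffunE eqxx; case: ifP => kC.
  rewrite (bigD1 (C :\ k)%SET) /=; last by rewrite finset.setD1K.
  rewrite mulr1 big1 ?addr0 // => B /andP[/eqP BC BD].
  rewrite /extsign disjoints1; case: (boolP (k \in B)) => kB; first by rewrite !mul0r.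
  by case/eqP: BD; rewrite -BC finset.setU1K.
rewrite big1 // => B /eqP BC; move: kC; rewrite -BC finset.setU11.
by [].
Qed.

(* Left contraction by the dual of e_k. *)
Definition contr k x : E :=
  [ffun A : {set 'I_n} => if k \in A then 0 else extsign K [set k]%SET A * x (k |: A)%SET].

Lemma contrE k x A :
  contr k x A = if k \in A then 0 else extsign K [set k]%SET A * x (k |: A)%SET.
Proof. by rewrite ffunE. Qed.

Lemma contr_is_linear k : linear (contr k).
Proof.
move=> a x y; apply/ffunP => A; rewrite !ffunE; case: ifP => _.
  by rewrite scaler0 addr0.
by rewrite /GRing.scale /=; ring.
Qed.
HB.instance Definition _ k := GRing.isLinear.Build K E E _ (contr k) (contr_is_linear k).

Lemma extsign1 k A : k \notin A ->
  extsign K [set k]%SET A = (-1) ^+ (\sum_(j in A) (j < k)%N).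
Proof. by move=> kA; rewrite /extsign disjoints1 kA /inversions finset.big_set1. Qed.

(** Contraction is an antiderivation with value 1 or 0 on e_l. This relation is what makes the
    Cartan complexes of free modules contractible. *)
Lemma contr_gen k l x :
  contr k (extgen K l * x) + extgen K l * contr k x = if k == l then x else 0.
Proof.
apply/ffunP => A.
have -> : (if k == l then x else 0) A = if k == l then x A else 0.
  by case: ifP => //; rewrite ffunE.
rewrite [LHS]ffunE /= contrE !extgen_mulE contrE.
rewrite !finset.in_setU1 !finset.in_setD1 [l == k]eq_sym.
have [->|kl] /= := eqVneq k l.
  case: ifP => lA; last first.
    by rewrite finset.setU1K ?lA // mulrA extsign1 ?lA // -expr2 sqrr_sign mul1r addr0.
  rewrite add0r finset.setD1K // mulrA extsign1 ?finset.setD11 //.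
  by rewrite -expr2 sqrr_sign mul1r.
case: (boolP (l \in A)) => lA; case: (boolP (k \in A)) => kA; rewrite ?mulr0 ?addr0 //.
have -> : ((k |: A) :\ l = k |: (A :\ l))%SET.
  by apply/setP => i; rewrite !inE; case: (eqVneq i l) => // ->; rewrite eq_sym (negPf kl).
rewrite !mulrA -mulrDl !extsign1 ?inE ?eqxx ?negb_or ?(negPf kA) ?andbF ?orbF //=;
  last by rewrite andbT eq_sym.
have -> : (\sum_(j in A) (j < k)%N = (l < k)%N + \sum_(j in (A :\ l)%SET) (j < k)%N)%N.
  by rewrite (bigD1 l) //=; congr addn; apply: eq_bigl => j; rewrite !inE andbC.
have -> : (\sum_(j in (k |: A :\ l)%SET) (j < l)%N
           = (k < l)%N + \sum_(j in (A :\ l)%SET) (j < l)%N)%N.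
  by rewrite (big_setU1) //= !inE negb_and kA orbT.
(* The two signs differ only by the relative position of k and l, and exactly one of k < l and l < k
   holds. *)
rewrite !exprD; case: (ltngtP k l) kl => [||/val_inj->]; rewrite ?eqxx // => _ _;
  rewrite /= expr0 expr1; ring.
Qed.

Lemma contr_deg k j x : extcomp j x = x -> extcomp (j - 1) (contr k x) = contr k x.
Proof.
move=> xj; apply/ffunP => A; rewrite !ffunE; case: ifP => // Aj; case: ifP => // kA.
rewrite -xj ffunE cardsU1 kA /=; case: eqP => [Hj|]; last by rewrite mulr0.
by move/eqP: Aj; case; rewrite -Hj PoszD addrC addKr.
Qed.

Lemma mul_extgenE k x C :
  (x * extgen K k) C =
  if k \in C then extsign K (C :\ k)%SET [set k]%SET * x (C :\ k)%SET else 0.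
Proof.
rewrite [LHS]ffunE; case: ifP => kC.
  rewrite (bigD1 (C :\ k)%SET) //= [X in _ + X]big1 => [|A AC]; last first.
    apply: big1 => B /eqP ABC; rewrite ffunE; case: eqP => [Bk|_]; last by rewrite mulr0.
    rewrite Bk /extsign; case: ifP => [dA|_]; last by rewrite !mul0r.
    case/eqP: AC; rewrite -ABC Bk finset.setUC finset.setU1K //.
    by rewrite disjoint_sym disjoints1 in dA.
  rewrite addr0 (bigD1 [set k]%SET) /=; last by rewrite finset.setUC finset.setD1K.
  rewrite ffunE eqxx mulr1 big1 ?addr0 // => B /andP[_ Bk].
  by rewrite ffunE (negPf Bk) mulr0.
rewrite big1 // => A _; apply: big1 => B /eqP ABC; rewrite ffunE.
case: eqP => [Bk|_]; last by rewrite mulr0.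
by move: kC; rewrite -ABC Bk inE finset.set11 orbT.
Qed.

Lemma extsign1r k A : k \notin A ->
  extsign K A [set k]%SET = (-1) ^+ #|A| * extsign K [set k]%SET A.
Proof.
move=> kA; rewrite extsign1 // /extsign disjoint_sym disjoints1 kA /inversions -exprD.
rewrite -signr_odd -[RHS]signr_odd; congr (_ ^+ (nat_of_bool _)).
rewrite -sum1_card -big_split /=.
(* For i != k one has 1 + [i < k] = [k < i] + 2 [i < k], and only parities matter. *)
rewrite [in RHS](eq_bigr (fun i : 'I_n => (k < i) + (i < k) * 2)%N) => [|i iA].
  rewrite big_split -big_distrl /= oddD oddM andbF addbF; congr (odd _).
  by apply: eq_bigr => i _; rewrite finset.big_set1.
have ik : i != k by apply: contraNneq kA => <-.
by case: ltngtP ik => // /val_inj ->; rewrite eqxx.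
Qed.

(** The witness is the image of x under the parity automorphism, so one y serves all k. Hence left
    scalars can be moved past elements of degree 1. *)
Lemma mul_extgen_sign x : exists y, forall k, x * extgen K k = extgen K k * y.
Proof.
exists [ffun A : {set 'I_n} => (-1) ^+ #|A| * x A] => k; apply/ffunP => C.
rewrite mul_extgenE extgen_mulE ffunE; case: ifP => // kC.
by rewrite extsign1r ?finset.setD11 // mulrA [_ * (-1) ^+ _]mulrC.
Qed.

End Contraction.

Section Cartan.
Variables (K : fieldType) (n : nat).
Local Notation E := (extalg K n).
Local Notation mon := 'X_{1..n}.

Lemma extcomp_linear j : linear (@extcomp K n j).
Proof.
move=> a x y; apply/ffunP => A; rewrite !ffunE; case: ifP => // _.
by rewrite scaler0 addr0.
Qed.
HB.instance Definition _ j := GRing.isLinear.Build K E E _ (@extcomp K n j) (extcomp_linear j).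

Lemma deg1_sum (v : E) : extcomp 1 v = v ->
  v = \sum_k (v [set k]%SET : K) *: extgen K k.
Proof.
move=> v1; apply/ffunP => A; rewrite sum_ffunE -{1}v1 ffunE.
case: ifP => [/eqP/(congr1 absz)/eqP/cards1P[k ->]|A1].
  rewrite (bigD1 k) //= !ffunE eqxx big1 => [|l lk].
    by rewrite addr0 /GRing.scale /= mulr1.
  rewrite !ffunE; case: eqP => [lk'|_]; last by rewrite /= scaler0.
  by case/eqP: lk; apply/eqP; rewrite eq_sym -finset.in_set1 -lk' finset.set11.
rewrite big1 // => l _; rewrite !ffunE; case: eqP => [lA|_]; last by rewrite /= scaler0.
by rewrite lA cards1 in A1.
Qed.

Lemma deg1_sqr (v : E) : extcomp 1 v = v -> v * v = 0.
Proof.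
move/deg1_sum => ->; rewrite mulr_suml.
under eq_bigr do rewrite mulr_sumr.
apply: sum_alternating => [k|k l]; rewrite -!scalerAl -!scalerAr.
  by rewrite extgen_sqr !scaler0.
by rewrite extgen_anticomm !scalerN !scalerA mulrC.
Qed.

Lemma deg1_anticomm (v w : E) : extcomp 1 v = v -> extcomp 1 w = w -> v * w = - (w * v).
Proof.
move=> v1 w1; apply/eqP; rewrite -addr_eq0; apply/eqP.
have := deg1_sqr (_ : extcomp 1 (v + w) = v + w).
rewrite extcompD v1 w1 => /(_ erefl).
by rewrite mulrDl !mulrDr !deg1_sqr // addr0 add0r.
Qed.

(* Cartan complexes with respect to w: chd is the differential of M (x) D, with
   D the divided power coalgebra, and cohd that of M (x) S, with S the symmetric
   algebra.  A family g stands for the sum of the g a (x) x^(a), resp.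
   g a (x) x^a. *)
Variable w : 'I_n -> E.

Definition chd (M : lmodType E) (g : mon -> M) (a : mon) : M :=
  \sum_k w k *: g (a + U_(k))%MM.

Definition cohd (M : lmodType E) (g : mon -> M) (a : mon) : M :=
  \sum_(k | (0 < a k)%N) w k *: g (a - U_(k))%MM.

Section Modules.
Variable M : lmodType E.
Implicit Types (g h : mon -> M) (N : submodClosed M).

Lemma chdD g h a : chd (fun b => g b + h b) a = chd g a + chd h a.
Proof. by rewrite /chd -big_split; apply: eq_bigr => k _; rewrite /= scalerDr. Qed.

Lemma chdN g a : chd (fun b => - g b) a = - chd g a.
Proof. by rewrite /chd -sumrN; apply: eq_bigr => k _; rewrite /= scalerN. Qed.

Lemma chdB g h a : chd (fun b => g b - h b) a = chd g a - chd h a.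
Proof. by rewrite chdD chdN. Qed.

Lemma cohdD g h a : cohd (fun b => g b + h b) a = cohd g a + cohd h a.
Proof. by rewrite /cohd -big_split; apply: eq_bigr => k _; rewrite /= scalerDr. Qed.

Lemma cohdN g a : cohd (fun b => - g b) a = - cohd g a.
Proof. by rewrite /cohd -sumrN; apply: eq_bigr => k _; rewrite /= scalerN. Qed.

Lemma cohdB g h a : cohd (fun b => g b - h b) a = cohd g a - cohd h a.
Proof. by rewrite cohdD cohdN. Qed.

Lemma chd_ext g h a : (forall b, mdeg b = (mdeg a).+1 -> g b = h b) -> chd g a = chd h a.
Proof. by move=> gh; apply: eq_bigr => k _; rewrite gh // mdegD mdeg1 addn1. Qed.

Lemma mdeg_subU (a : mon) k : (0 < a k)%N -> (mdeg (a - U_(k))%MM).+1 = mdeg a.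
Proof.
move=> ak; have le : (U_(k) <= a)%MM.
  by apply/mnm_lepP => i; rewrite mnm1E; case: eqP => // <-.
by rewrite -{2}(submK le) mdegD mdeg1 addn1.
Qed.

Lemma addUK (a : mon) k : (a + U_(k) - U_(k))%MM = a. Proof. exact: addmK. Qed.

Lemma subUK (a : mon) k : (0 < a k)%N -> (a - U_(k) + U_(k))%MM = a.
Proof.
by move=> ak; apply: submK; apply/mnm_lepP => i; rewrite mnm1E; case: eqP => // <-.
Qed.

Lemma cohd_ext g h a : (forall b, (mdeg b).+1 = mdeg a -> g b = h b) -> cohd g a = cohd h a.
Proof. by move=> gh; apply: eq_bigr => k ak; rewrite gh // mdeg_subU. Qed.

Lemma chd_sub N g a : (forall b, mdeg b = (mdeg a).+1 -> g b \in N) -> chd g a \in N.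
Proof. by move=> gN; apply: rpred_sum => k _; rewrite rpredZ // gN // mdegD mdeg1 addn1. Qed.

Lemma cohd_sub N g a : (forall b, (mdeg b).+1 = mdeg a -> g b \in N) -> cohd g a \in N.
Proof. by move=> gN; apply: rpred_sum => k ak; rewrite rpredZ // gN // mdeg_subU. Qed.

Hypothesis w1 : forall k, extcomp 1 (w k) = w k.

Lemma chdZ v g a : extcomp 1 v = v -> chd (fun b => v *: g b) a = - (v *: chd g a).
Proof.
move=> v1; rewrite /chd scaler_sumr -sumrN; apply: eq_bigr => k _.
by rewrite !scalerA (deg1_anticomm (w1 k) v1) scaleNr.
Qed.

Lemma cohdZ v g a : extcomp 1 v = v -> cohd (fun b => v *: g b) a = - (v *: cohd g a).
Proof.
move=> v1; rewrite /cohd scaler_sumr -sumrN; apply: eq_bigr => k _.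
by rewrite !scalerA (deg1_anticomm (w1 k) v1) scaleNr.
Qed.

Lemma chd_chd g a : chd (chd g) a = 0.
Proof.
rewrite /chd; under eq_bigr do rewrite scaler_sumr.
apply: sum_alternating => [k|k l]; rewrite !scalerA.
  by rewrite (deg1_sqr (w1 k)) scale0r.
by rewrite (deg1_anticomm (w1 k) (w1 l)) scaleNr -!addmA [(U_(k) + _)%MM]addmC.
Qed.

Lemma cohd_cohd g a : cohd (cohd g) a = 0.
Proof.
pose F k l := if (0 < a k)%N && (0 < (a - U_(k))%MM l)%N
  then (w k * w l) *: g (a - U_(k) - U_(l))%MM else 0.
transitivity (\sum_k \sum_l F k l).
  rewrite /cohd big_mkcond; apply: eq_bigr => k _; rewrite /F.
  case: ifP => ak; last by rewrite big1.
  by rewrite scaler_sumr big_mkcond; apply: eq_bigr => l _; rewrite scalerA.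
apply: sum_alternating => [k|k l]; rewrite /F.
  by rewrite (deg1_sqr (w1 k)) scale0r if_same.
have [->|kl] := eqVneq k l; first by rewrite (deg1_sqr (w1 l)) scale0r if_same oppr0.
rewrite !mnmBE !mnm1E [l == k]eq_sym (negPf kl) !subn0 andbC.
case: ifP => _; last by rewrite oppr0.
by rewrite (deg1_anticomm (w1 k) (w1 l)) scaleNr !submDA [(U_(k) + _)%MM]addmC.
Qed.

End Modules.
End Cartan.

(** * Homogeneous elements and maps of degree 0 *)

Section GradedBasics.
Variables (K : fieldType) (n : nat) (M : gmod K n).
Local Notation E := (extalg K n).
Implicit Types (x y : M) (j : int) (N : submodClosed M).

Lemma homog0 j : homogeneous j (0 : M). Proof. exact: gcomp0. Qed.

Lemma homogD j x y : homogeneous j x -> homogeneous j y -> homogeneous j (x + y).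
Proof. by rewrite /homogeneous gcompD => -> ->. Qed.

Lemma homogN j x : homogeneous j x -> homogeneous j (- x).
Proof. by rewrite /homogeneous gcompN => ->. Qed.

Lemma homogB j x y : homogeneous j x -> homogeneous j y -> homogeneous j (x - y).
Proof. by rewrite /homogeneous gcompB => -> ->. Qed.

Lemma homog_sum j I (r : seq I) (P : pred I) (F : I -> M) :
  (forall i, P i -> homogeneous j (F i)) -> homogeneous j (\sum_(i <- r | P i) F i).
Proof. by move=> FP; elim/big_ind: _ => //; [exact: homog0 | exact: homogD]. Qed.

Lemma homog_gcomp j x : homogeneous j (gcomp j x).
Proof. by rewrite /homogeneous gcomp_comp eqxx. Qed.

Lemma gcomp_homog i j x : homogeneous j x -> gcomp i x = if i == j then x else 0.
Proof. by move=> <-; rewrite gcomp_comp. Qed.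

Lemma gcompZ1 (v : E) j x : extcomp 1 v = v -> gcomp j (v *: x) = v *: gcomp (j - 1) x.
Proof. by move=> v1; rewrite -{1}[j](subrK 1) [j - 1 + 1]addrC -v1 gcompZ v1. Qed.

Lemma homogZ1 (v : E) j x : extcomp 1 v = v -> homogeneous (j - 1) x -> homogeneous j (v *: x).
Proof. by move=> v1 xj; rewrite /homogeneous gcompZ1 // xj. Qed.

Lemma homogZ1' (v : E) j x : extcomp 1 v = v -> homogeneous j x -> homogeneous (j + 1) (v *: x).
Proof. by move=> v1 xj; apply: homogZ1 => //; rewrite addrK. Qed.

Lemma extcomp0_scal (c : K) : extcomp 0 (c%:A : E) = c%:A.
Proof.
apply/ffunP => A; rewrite !ffunE; case: ifP => // A0; case: eqP => [AE|_];
  last by rewrite /= scaler0.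
by rewrite AE cards0 in A0.
Qed.

Lemma gcomp_scal j (c : K) x : gcomp j (c%:A *: x) = c%:A *: gcomp j x.
Proof. by rewrite -{1}[j]add0r -extcomp0_scal gcompZ extcomp0_scal. Qed.

Lemma homog_scal j (c : K) x : homogeneous j x -> homogeneous j (c%:A *: x).
Proof. by rewrite /homogeneous gcomp_scal => ->. Qed.

Lemma submodN N x : x \in N -> - x \in N.
Proof. by move=> xN; rewrite -scaleN1r rpredZ. Qed.

Lemma submodB N x y : x \in N -> y \in N -> x - y \in N.
Proof. by move=> xN yN; rewrite rpredD // submodN. Qed.

Lemma submodNE N x : (- x \in N) = (x \in N).
Proof. by apply/idP/idP => /submodN //; rewrite opprK. Qed.

End GradedBasics.

Section DegreeZero.
Variables (K : fieldType) (n : nat) (M P : gmod K n) (f : {linear M -> P}).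
Hypothesis f0 : degree0 f.

Lemma degree0_gcomp j x : f (gcomp j x) = gcomp j (f x).
Proof.
have [s us xE] := gcomp_sum x.
rewrite {2}xE raddf_sum gcomp_bigsum.
under eq_bigr => i _ do rewrite (gcomp_homog j (f0 (homog_gcomp i x))).
have gx : gcomp j x = \sum_(i <- s) if j == i then gcomp i x else 0.
  by rewrite {1}xE gcomp_bigsum; apply: eq_bigr => i _; rewrite gcomp_comp.
rewrite gx raddf_sum; apply: eq_bigr => i _; case: ifP => //; rewrite raddf0 //.
Qed.

Lemma degree0_lift j x y : homogeneous j y -> f x = y -> f (gcomp j x) = y.
Proof. by move=> yj fx; rewrite degree0_gcomp fx. Qed.

End DegreeZero.

(** * Exactness of Cartan complexes from contractions *)

Section Exactness.
Variables (K : fieldType) (n : nat).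
Local Notation E := (extalg K n).
Local Notation mon := 'X_{1..n}.
Variable w : 'I_n -> E.
Hypothesis w1 : forall k, extcomp 1 (w k) = w k.

(* These concern the Cartan complex of M/N; i is the degree in D, resp. S. *)
Definition chain_exact (M : gmod K n) (N : {pred M}) (i : nat) (j : int) :=
  forall g : mon -> M, (forall a, homogeneous j (g a)) ->
    (forall b, (mdeg b).+1 = i -> chd w g b \in N) ->
  exists2 h : mon -> M, forall a, homogeneous (j - 1) (h a) &
    forall a, mdeg a = i -> g a - chd w h a \in N.

Definition cochain_exact (M : gmod K n) (N : {pred M}) (i : nat) (j : int) :=
  forall g : mon -> M, (forall a, homogeneous j (g a)) ->
    (forall b, mdeg b = i.+1 -> cohd w g b \in N) ->
  exists2 h : mon -> M, forall a, homogeneous (j - 1) (h a) &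
    forall a, mdeg a = i -> g a - cohd w h a \in N.

Section Homog.
Variable M : gmod K n.
Implicit Types (g h : mon -> M).

Lemma chd_homog j h a : (forall a, homogeneous (j - 1) (h a)) -> homogeneous j (chd w h a).
Proof. by move=> hj; apply: homog_sum => k _; apply: homogZ1. Qed.

Lemma cohd_homog j h a : (forall a, homogeneous (j - 1) (h a)) -> homogeneous j (cohd w h a).
Proof. by move=> hj; apply: homog_sum => k _; apply: homogZ1. Qed.

End Homog.

Section Contraction.
Variables (M : gmod K n) (theta : 'I_n -> M -> M).
Hypothesis thetaD : forall k, {morph theta k : x y / x + y}.
Hypothesis thetaw : forall k l x,
  theta k (w l *: x) + w l *: theta k x = if k == l then x else 0.
Hypothesis theta_deg : forall k j x, homogeneous j x -> homogeneous (j - 1) (theta k x).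

Let theta0 k : theta k 0 = 0.
Proof. by apply: (addrI (theta k 0)); rewrite -thetaD !addr0. Qed.

Let theta_sum k I (r : seq I) (P : pred I) (F : I -> M) :
  theta k (\sum_(i <- r | P i) F i) = \sum_(i <- r | P i) theta k (F i).
Proof. exact: (big_morph _ (@thetaD k) (theta0 k)). Qed.

(** Homotopy for a single variable: multiplication by x_k combined with [theta k]. Treating the
    variables one at a time avoids dividing by a degree, so the characteristic of K is arbitrary. *)
Let hk k (g : mon -> M) (a : mon) := if (0 < a k)%N then theta k (g (a - U_(k))%MM) else 0.

Let chd_hk k g a : chd w (hk k g) a + hk k (chd w g) a =
  if (0 < a k)%N then g a else w k *: theta k (g a).
Proof.
rewrite /hk; case: ifP => ak.
  rewrite theta_sum -big_split (bigD1 k) //= big1 ?addr0 => [|l lk];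
    rewrite mnmDE ltn_addr // addrC.
    by rewrite addUK subUK // thetaw eqxx.
  have -> : (a + U_(l) - U_(k) = a - U_(k) + U_(l))%MM.
    apply/mnmP => i; rewrite !mnmDE !mnmBE mnmDE !mnm1E.
    have [ki|_] := eqVneq k i; last by rewrite !subn0.
    by rewrite -ki; lia.
  by rewrite thetaw eq_sym (negPf lk).
rewrite addr0 /chd (bigD1 k) //= mnmDE mnm1E eqxx addn1 addUK big1 ?addr0 // => l lk.
by rewrite mnmDE mnm1E (negPf lk) addn0 ak scaler0.
Qed.

(** Over S the homotopy divides by x_k instead, dropping the monomials without x_k. *)
Let hk' k (g : mon -> M) (a : mon) := theta k (g (a + U_(k))%MM).

Let cohd_hk' k g a : cohd w (hk' k g) a + hk' k (cohd w g) a =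
  if (0 < a k)%N then g a else theta k (w k *: g a).
Proof.
rewrite /hk' /cohd theta_sum.
rewrite [X in _ + X](bigD1 k) /=; last by rewrite mnmDE mnm1E eqxx addn1.
rewrite addUK.
have -> : \sum_(i | (0 < (a + U_(k))%MM i)%N && (i != k)) theta k (w i *: g (a + U_(k) - U_(i))%MM)
  = - \sum_(i | (0 < a i)%N && (i != k)) w i *: theta k (g (a + U_(k) - U_(i))%MM).
  rewrite -sumrN; apply: eq_big => [i|i /andP[_ ik]].
    by rewrite mnmDE mnm1E [k == i]eq_sym; case: eqP; rewrite ?andbF ?addn0.
  apply/eqP; rewrite -addr_eq0; have := thetaw k i (g (a + U_(k) - U_(i))%MM).
  by rewrite eq_sym (negPf ik) => ->.
rewrite (bigID (fun i => i == k)) /=.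
have -> : \sum_(i | (0 < a i)%N && (i != k)) w i *: theta k (g (a - U_(i) + U_(k))%MM)
  = \sum_(i | (0 < a i)%N && (i != k)) w i *: theta k (g (a + U_(k) - U_(i))%MM).
  apply: eq_bigr => i /andP[ai ik]; congr (_ *: theta k (g _)).
  apply/mnmP => l; rewrite !mnmDE !mnmBE mnmDE !mnm1E.
  have [il|_] := eqVneq i l; last by rewrite !subn0.
  have [kl|_] := eqVneq k l; first by rewrite kl il eqxx in ik.
  by rewrite !addn0.
rewrite addrACA subrr addr0.
case: ifP => ak.
  rewrite (big_pred1 k) => [|i]; last by rewrite /= andbC; case: eqP => [->|].
  by rewrite subUK // addrC thetaw eqxx.
rewrite big_pred0 => [|i]; last by rewrite andbC; case: eqP => [->|].
rewrite add0r //.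
Qed.

Lemma contraction_chain_exact i j : (0 < i)%N -> chain_exact (pred1 (0 : M)) i j.
Proof.
move=> i0 g gj gc.
(* Truncation to degree i turns g into a cycle in every degree, as the homotopy formula requires. *)
pose g0 a := if mdeg a == i then g a else 0.
have g0j a : homogeneous j (g0 a) by rewrite /g0; case: ifP => // _; exact: homog0.
have g0c a : chd w g0 a = 0.
  case: (eqVneq (mdeg a).+1 i) => ai; last first.
    rewrite /chd big1 // => k _; rewrite /g0 mdegD mdeg1 addn1 (negPf ai) scaler0 //.
  rewrite (@chd_ext _ _ _ _ _ g) => [|b ba]; first exact/eqP/gc.
  by rewrite /g0 ba ai eqxx.
(* Invariant of the recursion over the variables: g' is a cycle homologous to g0 that vanishes on
   every monomial containing a variable already treated. At the end it vanishes in degree i, since i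
   > 0 leaves no monomial without variables. *)
suff [h [g' [hj g'j gE g'c g'0]]] : exists h g', [/\ forall a, homogeneous (j - 1) (h a),
   forall a, homogeneous j (g' a), forall a, g0 a = g' a + chd w h a, forall a, chd w g' a = 0 &
   forall a, (mdeg a != i) || has (fun k => (0 < a k)%N) (enum 'I_n) -> g' a = 0].
  exists h => // a ai; rewrite inE; have := gE a; rewrite /g0 ai eqxx => ->.
  rewrite addrK g'0 // ai eqxx /=; apply/negPn/negP => /hasPn ha.
  move: i0; rewrite -ai lt0n => /negP[]; rewrite mdegE sum_nat_eq0.
  by apply/forallP => k; apply/implyP => _; rewrite eqn0Ngt ha ?mem_enum.
elim: (enum _) => [|k r [h [g' [hj g'j gE g'c g'0]]]].
  exists (fun=> 0), g0; split=> // [a|a|a]; first exact: homog0.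
    by rewrite /chd big1 ?addr0 // => k _; rewrite scaler0.
  by rewrite orbF /g0 => /negPf ->.
have E2 a : g' a - chd w (hk k g') a = if (0 < a k)%N then 0 else g' a - w k *: theta k (g' a).
  have := chd_hk k g' a; rewrite {2}/hk g'c theta0 if_same addr0 => ->.
  by case: ifP; rewrite ?subrr.
have hkj a : homogeneous (j - 1) (hk k g' a).
  by rewrite /hk; case: ifP => _; [exact: theta_deg | exact: homog0].
exists (fun a => h a + hk k g' a), (fun a => g' a - chd w (hk k g') a); split=> [a|a|a|a|a].
- exact: homogD.
- by apply: homogB => //; apply: chd_homog.
- by rewrite chdD gE addrACA addNr addr0.
- by rewrite chdB g'c (chd_chd w1) subr0.
rewrite E2 /=; case: ifP => //= _ Ha.
by rewrite g'0 // theta0 scaler0 subr0.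
Qed.

Lemma contraction_cochain_exact i j : (0 < i)%N -> cochain_exact (pred1 (0 : M)) i j.
Proof.
move=> i0 g gj gc.
pose g0 a := if mdeg a == i then g a else 0.
have g0j a : homogeneous j (g0 a) by rewrite /g0; case: ifP => // _; exact: homog0.
(* From here on the argument is the one for [chd], with [hk'] as the homotopy. *)
have g0c a : cohd w g0 a = 0.
  case: (eqVneq (mdeg a) i.+1) => ai; last first.
    rewrite /cohd big1 // => k ak; rewrite /g0 -eqSS mdeg_subU // (negPf ai) scaler0 //.
  rewrite (@cohd_ext _ _ _ _ _ g) => [|b]; first exact/eqP/gc.
  by rewrite ai => -[bi]; rewrite /g0 bi eqxx.
suff [h [g' [hj g'j gE g'c g'0]]] : exists h g', [/\ forall a, homogeneous (j - 1) (h a),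
   forall a, homogeneous j (g' a), forall a, g0 a = g' a + cohd w h a, forall a, cohd w g' a = 0 &
   forall a, (mdeg a != i) || has (fun k => (0 < a k)%N) (enum 'I_n) -> g' a = 0].
  exists h => // a ai; rewrite inE; have := gE a; rewrite /g0 ai eqxx => ->.
  rewrite addrK g'0 // ai eqxx /=; apply/negPn/negP => /hasPn ha.
  move: i0; rewrite -ai lt0n => /negP[]; rewrite mdegE sum_nat_eq0.
  by apply/forallP => k; apply/implyP => _; rewrite eqn0Ngt ha ?mem_enum.
elim: (enum _) => [|k r [h [g' [hj g'j gE g'c g'0]]]].
  exists (fun=> 0), g0; split=> // [a|a|a]; first exact: homog0.
    by rewrite /cohd big1 ?addr0 // => k _; rewrite scaler0.
  by rewrite orbF /g0 => /negPf ->.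
have E2 a : g' a - cohd w (hk' k g') a = if (0 < a k)%N then 0 else g' a - theta k (w k *: g' a).
  have := cohd_hk' k g' a; rewrite {2}/hk' g'c theta0 addr0 => ->.
  by case: ifP; rewrite ?subrr.
have hkj a : homogeneous (j - 1) (hk' k g' a) by apply: theta_deg.
exists (fun a => h a + hk' k g' a), (fun a => g' a - cohd w (hk' k g') a); split=> [a|a|a|a|a].
- exact: homogD.
- by apply: homogB => //; apply: cohd_homog.
- by rewrite cohdD gE addrACA addNr addr0.
- by rewrite cohdB g'c (cohd_cohd w1) subr0.
rewrite E2 /=; case: ifP => //= _ Ha.
by rewrite g'0 // scaler0 theta0 subr0.
Qed.

End Contraction.

End Exactness.

(** * Free modules and regular elements *)

Section Basis.
Variables (K : fieldType) (n : nat).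
Local Notation E := (extalg K n).
Local Notation mon := 'X_{1..n}.

Lemma contr_deg1 (v y : E) k : extcomp 1 v = v ->
  contr k (v * y) + v * contr k y = (v [set k]%SET : K) *: y.
Proof.
move=> v1; rewrite {1 2}(deg1_sum v1) !mulr_suml raddf_sum -big_split /= (bigD1 k) //=.
rewrite big1 => [|l lk]; rewrite -!scalerAl linearZ -scalerDr contr_gen.
  by rewrite eqxx addr0.
by rewrite eq_sym (negPf lk) scaler0.
Qed.

(** Says that w is a basis of E_1: G inverts its coefficient matrix and gives the dual basis in
    terms of the duals of the e_m. *)
Definition cartan_basis (w : 'I_n -> E) :=
  (forall k, extcomp 1 (w k) = w k) /\
  exists G : 'I_n -> 'I_n -> K, forall j k,
    \sum_m w j [set m]%SET * G m k = (j == k)%:R.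

Lemma cartan_basis_extgen : cartan_basis (@extgen K n).
Proof.
split=> [k|]; first exact: extcomp_extgen.
exists (fun m k => (m == k)%:R) => j k.
rewrite (bigD1 k) //= eqxx mulr1 big1 ?addr0 => [|m mk]; last by rewrite (negPf mk) mulr0.
rewrite ffunE; congr (nat_of_bool _)%:R; apply/eqP/eqP => [jk|->//]; apply/eqP.
by rewrite eq_sym -finset.in_set1 -jk finset.set11.
Qed.

Section Free.
Variables (w : 'I_n -> E) (s : seq int).
Hypothesis wB : cartan_basis w.

Let w1 := wB.1.

Lemma gfree_contraction : exists theta : 'I_n -> gfree K n s -> gfree K n s,
  [/\ forall k, {morph theta k : x y / x + y},
      forall k l x, theta k (w l *: x) + w l *: theta k x = if k == l then x else 0 &
      forall k j x, homogeneous j x -> homogeneous (j - 1) (theta k x)].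
Proof.
have [_ [G GE]] := wB.
(* Entrywise contraction by the k-th vector of the dual basis of w. *)
exists (fun k (x : 'rV[E]_(size s)) => \row_c \sum_m G m k *: contr m (x 0 c) : 'rV_(size s)).
split=> [k x y|k l x|k j x xj]; apply/rowP => c; rewrite !mxE.
- rewrite -big_split; apply: eq_bigr => m _; rewrite /= -scalerDr -raddfD.
  by congr (_ *: contr _ _); exact: mxE.
- have -> : (if k == l then x else 0) 0 c = (k == l)%:R *: x 0 c.
    by case: ifP => _; rewrite ?scale1r ?scale0r //; exact: mxE.
  rewrite eq_sym -GE scaler_suml mulr_sumr -big_split; apply: eq_bigr => m _ /=.
  rewrite -scalerAr -scalerDr mulrC -scalerA -contr_deg1 ?w1 //.
rewrite linear_sum; apply: eq_bigr => m _; rewrite /= linearZ /= addrA contr_deg //.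
by have := congr1 (fun y : 'rV__ => y 0 c) xj; rewrite mxE.
Qed.

Lemma gfree_chain_exact i j : (0 < i)%N -> chain_exact w (pred1 (0 : gfree K n s)) i j.
Proof.
have [theta [tD tw td]] := gfree_contraction.
exact: contraction_chain_exact tD tw td _ _.
Qed.

Lemma gfree_cochain_exact i j : (0 < i)%N -> cochain_exact w (pred1 (0 : gfree K n s)) i j.
Proof.
have [theta [tD tw td]] := gfree_contraction.
exact: contraction_cochain_exact tD tw td _ _.
Qed.

End Free.
End Basis.

(** * Cartan complexes of M/N and M/(N + vM) for v regular *)

Section RegularStep.
Variables (K : fieldType) (n : nat).
Local Notation E := (extalg K n).
Local Notation mon := 'X_{1..n}.
Variable w : 'I_n -> E.
Hypothesis w1 : forall k, extcomp 1 (w k) = w k.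
Variable M : gmod K n.

(* v is regular on M/N, and N' = N + vM. *)
Definition regular_step (N N' : submodClosed M) (v : E) :=
  (forall x, x \in N' <-> exists y, x - v *: y \in N) /\
  (forall x, v *: x \in N <-> x \in N').

Variables (N N' : submodClosed M) (v : E).
Hypotheses (v1 : extcomp 1 v = v) (gN : graded_submod N) (vNN' : regular_step N N' v).

Let sumE x : x \in N' <-> exists y, x - v *: y \in N. Proof. exact: vNN'.1. Qed.
Let regE x : v *: x \in N <-> x \in N'. Proof. exact: vNN'.2. Qed.

Let sub x : x \in N -> x \in N'.
Proof. by move=> xN; apply/sumE; exists 0; rewrite scaler0 subr0. Qed.

(** Homogeneous division by v modulo N. The value 0 off P makes the boundary of l known in the other
    degrees too. *)
Let lift (P : pred mon) j (g : mon -> M) :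
  (forall a, homogeneous j (g a)) -> (forall a, P a -> g a \in N') ->
  exists l : mon -> M, [/\ forall a, homogeneous (j - 1) (l a),
    forall a, ~~ P a -> l a = 0 & forall a, P a -> g a - v *: l a \in N].
Proof.
move=> gj gN'.
suff /choice[l lP] : forall a, exists y, [/\ homogeneous (j - 1) y, ~~ P a -> y = 0 &
    P a -> g a - v *: y \in N].
  by exists l; split=> a; have [] := lP a.
move=> a; case: (boolP (P a)) => Pa; last by exists 0; split=> //; exact: homog0.
have [y gy] := (sumE _).1 (gN' a Pa).
exists (gcomp (j - 1) y); split=> // [|_]; first exact: homog_gcomp.
by have := gN j gy; rewrite gcompB gcompZ1 // (gj a).
Qed.

(** Chase in 0 -> M/N' -> M/N -> M/N' -> 0, the first map being v. For a cocycle u modulo N', v u is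
    the boundary of some g, and g is a cocycle modulo N' of the same M-degree and of S-degree one
    less; hence the induction on i. In S-degree 0 there are no boundaries, so v u is in N and u in
    N'. *)
Lemma cochain_exact_step j :
  (forall i, cochain_exact w N i (j + 1)) -> forall i, cochain_exact w N' i j.
Proof.
move=> ex; elim=> [|i IH] u uj uc.
  have [a||g gj gE] := ex 0 (fun a => v *: u a); first exact: homogZ1'.
    by move=> b b1; rewrite cohdZ // submodN //; apply/regE/uc.
  exists (fun=> 0) => [a|a a0]; first exact: homog0.
  have c0 (h : mon -> M) : cohd w h a = 0.
    rewrite /cohd big_pred0 // => k; have /eqP := a0.
    by rewrite mdeg_eq0 => /eqP ->; rewrite mnm0E.
  by rewrite c0 subr0; apply/regE; have := gE a a0; rewrite c0 subr0.
have [a||g gj gE] := ex i.+1 (fun a => v *: u a); first exact: homogZ1'.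
  by move=> b b1; rewrite cohdZ // submodN //; apply/regE/uc.
rewrite addrK in gj.
have gc b : mdeg b = i.+1 -> cohd w g b \in N'.
  by move=> /gE bN; apply/sumE; exists (u b); rewrite -submodNE opprB.
have [k kj kE] := IH g gj gc.
have [a|a /eqP /kE|l [lj _ lE]] := @lift (fun a => mdeg a == i) j (fun a => g a - cohd w k a).
- by apply: homogB => //; apply: cohd_homog.
- by [].
exists (fun a => - l a) => [a|a ai]; first exact: homogN.
rewrite cohdN opprK; apply/regE.
have H1 : cohd w (fun a => g a - cohd w k a - v *: l a) a \in N.
  by apply: cohd_sub => b; rewrite ai => -[bi]; apply: lE; rewrite bi.
move: H1; rewrite cohdB cohdB (cohd_cohd w1) subr0 cohdZ // opprK => H1.
by rewrite scalerDr -(subrK (cohd w g a) (v *: u a)) -addrA rpredD // gE.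
Qed.

(** The connecting map sends g to the u with chd g = v u modulo N. By induction u is a boundary
    [chd w l] modulo N', and then g + v l is a cycle modulo N that agrees with g modulo N'. *)
Lemma chain_exact_step j :
  (forall i, chain_exact w N i j) -> forall i, chain_exact w N' i j.
Proof.
move=> ex; elim=> [|i IH] g gj gc.
  have [|h hj hE] := ex 0 g gj; [by []|].
  by exists h => // a /hE /sub.
have gcj a : homogeneous (j + 1) (chd w g a) by apply: chd_homog => // b; rewrite addrK.
have [|u [uj _ uE]] := @lift (fun a => mdeg a == i) (j + 1) (chd w g) gcj.
  by move=> b /eqP bi; apply: gc; rewrite bi.
rewrite addrK in uj.
have uc b : (mdeg b).+1 = i -> chd w u b \in N'.
  move=> bi; apply/regE; have : chd w (fun a => chd w g a - v *: u a) b \in N.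
    by apply: chd_sub => c cb; apply: uE; rewrite cb bi.
  by rewrite chdB (chd_chd w1) sub0r chdZ // opprK.
have [l lj lE] := IH u uj uc.
have [a|b [bi]|h hj hE] := ex i.+1 (fun a => g a + v *: l a).
- by apply: homogD => //; apply: homogZ1.
- rewrite chdD chdZ //.
  have -> : chd w g b - v *: chd w l b = chd w g b - v *: u b + v *: (u b - chd w l b).
    by rewrite scalerBr addrA subrK.
  by rewrite rpredD //; [apply: uE; rewrite bi | apply/regE/lE].
exists h => // a ai; apply/sumE; exists (- l a).
by rewrite scalerN opprK addrAC hE.
Qed.

Section Layers.
Variable k0 : 'I_n.
Hypothesis wk0 : w k0 = v.

Let chd' (h : mon -> M) a := \sum_(k | k != k0) w k *: h (a + U_(k))%MM.

Let chd_split h a : chd w h a = v *: h (a + U_(k0))%MM + chd' h a.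
Proof. by rewrite /chd (bigD1 k0) //= wk0. Qed.

Let chd'D g h a : chd' (fun b => g b + h b) a = chd' g a + chd' h a.
Proof. by rewrite /chd' -big_split; apply: eq_bigr => k _; rewrite scalerDr. Qed.

Let chd'Z g a : chd' (fun b => v *: g b) a = - (v *: chd' g a).
Proof.
rewrite /chd' scaler_sumr -sumrN; apply: eq_bigr => k _.
by rewrite !scalerA (deg1_anticomm (w1 k) v1) scaleNr.
Qed.

Let chd'_chd' g a : chd' (chd' g) a = 0.
Proof.
pose F k l := if (k != k0) && (l != k0)
  then (w k * w l) *: g (a + U_(k) + U_(l))%MM else 0.
transitivity (\sum_k \sum_l F k l).
  rewrite /chd' big_mkcond; apply: eq_bigr => k _; rewrite /F.
  case: ifP => kk; last by rewrite big1.
  by rewrite scaler_sumr big_mkcond; apply: eq_bigr => l _; rewrite scalerA.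
apply: sum_alternating => [k|k l]; rewrite /F.
  by rewrite (deg1_sqr (w1 k)) scale0r if_same.
rewrite andbC; case: ifP => _; last by rewrite oppr0.
by rewrite (deg1_anticomm (w1 k) (w1 l)) scaleNr -!addmA [(U_(k) + _)%MM]addmC.
Qed.

Let chd'_sub g a : (forall b, g b \in N) -> chd' g a \in N.
Proof. by move=> gbN; apply: rpred_sum => k _; rewrite rpredZ. Qed.

Let chd'_homog j h a : (forall b, homogeneous (j - 1) (h b)) -> homogeneous j (chd' h a).
Proof. by move=> hj; apply: homog_sum => k _; apply: homogZ1. Qed.

(** The condition under which a layer can be continued: v times the next layer must equal v u - chd'
    H modulo N, so chd' H has to be divisible by v. *)
Let good j (H : mon -> M) :=
  (forall a, homogeneous (j - 1) (H a)) /\ forall a, chd' H a \in N'.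

(* The layers a k0 = c of a family h with chd h = v u are built by recursion on
   c, as a power series in the variable dual to v. *)
Let next_layer j (u H : mon -> M) :
  (forall a, homogeneous (j - 1) (u a)) -> (forall a, chd w u a \in N') -> good j H ->
  exists H', good j H' /\
    forall a, v *: H' (a + U_(k0))%MM + chd' H a - v *: u a \in N.
Proof.
move=> uj uc [Hj Hc].
have [a|//|b [bj _ bE]] := @lift xpredT j (chd' H); first exact: chd'_homog.
(* With chd' H = v b modulo N the equation for the next layer becomes v H' = v (u - b). The shift by
   U_(k0) places the solution one layer higher. *)
exists (fun a : mon => if (0 < a k0)%N then u (a - U_(k0))%MM - b (a - U_(k0))%MM else 0).
split; last first.
  move=> a; rewrite mnmDE mnm1E eqxx addn1 addUK scalerBr.
  by rewrite addrAC [_ - _ - _]addrAC subrr sub0r addrC; apply: bE.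
split=> [a|a]; first by case: ifP => _; [exact: homogB | exact: homog0].
(* By regularity it is enough that v times chd' H' lies in N. For the part from u, chd' u is in N'
   because chd u and multiples of v are; for the part from b, v chd' b is up to sign chd' (chd' H) =
   0 modulo N. *)
apply/regE; case: (posnP (a k0)) => a0.
  rewrite [chd' _ _]big1 ?scaler0 ?rpred0 // => k kk.
  by rewrite mnmDE mnm1E (negPf kk) a0 scaler0.
set a' := (a - U_(k0))%MM.
have -> : chd' (fun a : mon => if (0 < a k0)%N then u (a - U_(k0))%MM - b (a - U_(k0))%MM else 0) a
    = chd' u a' - chd' b a'.
  rewrite /chd' -sumrB; apply: eq_bigr => k kk; rewrite -scalerBr.
  rewrite mnmDE mnm1E (negPf kk) addn0 a0.
  suff -> : (a + U_(k) - U_(k0) = a' + U_(k))%MM by [].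
  apply/mnmP => l; rewrite mnmBE !mnmDE mnmBE !mnm1E.
  have [kl|_] := eqVneq k0 l; last by rewrite !subn0.
  by rewrite -kl (negPf kk) !addn0.
rewrite scalerBr submodB //.
  apply/regE; have := uc a'; rewrite chd_split => uc'.
  rewrite -(addKr (v *: u (a' + U_(k0))%MM) (chd' u a')) rpredD // submodN //.
  by apply/sumE; exists (u (a' + U_(k0))%MM); rewrite subrr rpred0.
have : chd' (fun c => chd' H c - v *: b c) a' \in N by apply: chd'_sub => c; apply: bE.
rewrite (_ : chd' _ a' = v *: chd' b a') //.
rewrite (_ : (fun c => _) = fun c => chd' H c + v *: (- b c)); last first.
  by apply/funext => c; rewrite scalerN.
rewrite chd'D chd'_chd' add0r chd'Z -scalerN; congr (_ *: _).
by rewrite /chd' -sumrN; apply: eq_bigr => k _; rewrite scalerN opprK.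
Qed.

Let chd_layers j (u : mon -> M) :
  (forall a, homogeneous (j - 1) (u a)) -> (forall a, chd w u a \in N') ->
  exists2 h, forall a, homogeneous (j - 1) (h a) & forall a, v *: u a - chd w h a \in N.
Proof.
move=> uj uc.
have good0 : good j (fun=> 0).
  split=> a; first exact: homog0.
  by rewrite [chd' _ _]big1 ?rpred0 // => k _; rewrite scaler0.
have /choice[F FE] (H : {H | good j H}) : exists H' : {H | good j H}, forall a,
    v *: sval H' (a + U_(k0))%MM + chd' (sval H) a - v *: u a \in N.
  by have [H' [gH' HE]] := next_layer uj uc (svalP H); exists (exist _ H' gH').
(* Of the family [Hs c] only the monomials with exponent c at k0 are used; layer 0 is zero. *)
pose Hs c := iter c F (exist _ _ good0).
exists (fun a : mon => sval (Hs (a k0)) a) => a; first exact: (svalP (Hs (a k0))).1.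
rewrite -submodNE opprB chd_split mnmDE mnm1E eqxx addn1.
rewrite [X in _ + X - _](_ : _ = chd' (sval (Hs (a k0))) a); first exact: FE.
by apply: eq_bigr => k kk; rewrite mnmDE mnm1E (negPf kk) addn0.
Qed.

(** By [chd_layers], v : M/N' -> M/N is zero on homology, so the homology of M/N embeds into that of
    M/N' with the same i and j. *)
Lemma chain_exact_lift i j : chain_exact w N' i j -> chain_exact w N i j.
Proof.
move=> ex g gj gc.
have [b bi|h hj hE] := ex g gj; first exact/sub/gc.
have [a|a /eqP/hE|u [uj u0 uE]] := @lift (fun a => mdeg a == i) j (fun a => g a - chd w h a).
- by apply: homogB => //; apply: chd_homog.
- by [].
have [a|k kj kE] := chd_layers uj.
  case: (eqVneq (mdeg a).+1 i) => ai; last first.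
    rewrite /chd big1 ?rpred0 // => k _.
    by rewrite u0 ?scaler0 // mdegD mdeg1 addn1.
  apply/regE; have : chd w (fun b => g b - chd w h b - v *: u b) a \in N.
    by apply: chd_sub => b ba; apply: uE; rewrite ba ai.
  rewrite chdB chdB (chd_chd w1) subr0 chdZ // opprK => cN.
  by rewrite -(addKr (chd w g a) (v *: chd w u a)) rpredD //; apply: submodN; exact: gc.
exists (fun a => h a + k a) => a; first exact: homogD.
move=> ai; rewrite chdD opprD addrA -(subrK (v *: u a) (g a - chd w h a)) -addrA rpredD //.
by apply: uE; rewrite ai.
Qed.

End Layers.
End RegularStep.

(** * Tor and the Cartan complex *)

Section TorShift.
Variables (K : fieldType) (n : nat).
Local Notation E := (extalg K n).
Local Notation mon := 'X_{1..n}.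
Lemma extgen_basisE (w : 'I_n -> E) (G : 'I_n -> 'I_n -> K) :
  (forall k, extcomp 1 (w k) = w k) ->
  (forall j k, \sum_m w j [set m]%SET * G m k = (j == k)%:R) ->
  forall m, extgen K m = \sum_k G m k *: w k.
Proof.
move=> w1 GE m.
pose W : 'M[K]_n := \matrix_(j, m) w j [set m]%SET.
have /mulmx1C GW : W *m (\matrix_(m, k) G m k) = 1%:M.
  by apply/matrixP => j k; rewrite !mxE -GE; apply: eq_bigr => l _; rewrite !mxE.
transitivity (\sum_l (m == l)%:R *: extgen K l).
  rewrite (bigD1 m) //= eqxx scale1r big1 ?addr0 // => l lm.
  by rewrite eq_sym (negPf lm) scale0r.
under [RHS]eq_bigr => k _ do rewrite (deg1_sum (w1 k)) scaler_sumr.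
rewrite exchange_big; apply: eq_bigr => l _ /=.
have := congr1 (fun A : 'M_n => A m l) GW; rewrite !mxE => <-.
by rewrite scaler_suml; apply: eq_bigr => k _; rewrite !mxE scalerA.
Qed.

Variable w : 'I_n -> E.
Hypothesis wB : cartan_basis w.
Let w1 := wB.1.

Lemma chd_linear (M P : lmodType E) (f : {linear M -> P}) (g : mon -> M) a :
  f (chd w g a) = chd w (fun b => f (g b)) a.
Proof. by rewrite linear_sum; apply: eq_bigr => k _; rewrite linearZ. Qed.

Lemma cohd_linear (M P : lmodType E) (f : {linear M -> P}) (g : mon -> M) a :
  f (cohd w g a) = cohd w (fun b => f (g b)) a.
Proof. by rewrite linear_sum; apply: eq_bigr => k _; rewrite linearZ. Qed.

Section Maximal.
Variable X : gmod K n.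
Local Notation mX := (idealmul (extgens K n) X).

Lemma maximal_closed v (x : X) : extcomp 1 v = v -> v *: x \in mX.
Proof.
move=> /deg1_sum ->; rewrite scaler_suml; apply: rpred_sum => k _.
rewrite -[extgen K k]mul1r scalerAl -scalerA rpredZ //; apply: gensub_sub; exists (extgen K k), x.
by rewrite map_f ?mem_enum.
Qed.

Lemma chd_maximal (g : mon -> X) a : chd w g a \in mX.
Proof. by apply: rpred_sum => k _; apply: maximal_closed. Qed.

(** Identifies the maximal ideal times X with the boundaries of D-degree 0; this is how the tensor
    product with K enters the Cartan complex. *)
Lemma maximal_chd j (x : X) : homogeneous j x -> x \in mX ->
  exists2 g : mon -> X, forall a, homogeneous (j - 1) (g a) & x = chd w g 0%MM.
Proof.
move=> xj xm.
suff [g gE] : exists g, x = chd w g 0%MM.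
  exists (fun a => gcomp (j - 1) (g a)) => [a|]; first exact: homog_gcomp.
  rewrite -xj gE gcomp_bigsum; apply: eq_bigr => k _; exact: gcompZ1.
suff [y yE] : exists y : 'I_n -> X, x = \sum_k w k *: y k.
  exists (fun a => \sum_k if a == U_(k)%MM then y k else 0).
  rewrite yE; apply: eq_bigr => k _; rewrite add0m (bigD1 k) //= eqxx.
  rewrite big1 ?addr0 // => l lk; case: eqP => // /mnmP/(_ k).
  by rewrite !mnm1E eqxx (negPf lk).
move: xm; elim/gensub_ind => [|_ [_ [z [/mapP[m _ ->] ->]]]].
  split=> [|a y z [y' ->] [z' ->]].
    by exists (fun=> 0); rewrite big1 // => k _; rewrite scaler0.
  (* Left multiplication by a preserves the form of the sum, since a w_k = w_k b with b independent
     of k. *)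
  have [b bE] := mul_extgen_sign a.
  exists (fun k => b *: y' k + z' k).
  rewrite scaler_sumr -big_split; apply: eq_bigr => k _ /=.
  rewrite scalerDr !scalerA; congr (_ *: _ + _).
  rewrite (deg1_sum (w1 k)) mulr_sumr mulr_suml; apply: eq_bigr => l _.
  by rewrite -scalerAr -scalerAl bE.
have [_ [G GE]] := wB; rewrite (extgen_basisE w1 GE m); exists (fun k => (G m k)%:A *: z).
rewrite scaler_suml; apply: eq_bigr => k _.
by rewrite scalerA -scalerAr mulr1.
Qed.

End Maximal.

Section Resolution.
Variables (M : gmod K n) (F : free_resolution M).

Local Notation Fr i := (gfree K n (fr_shift F i)).
Local Notation df i := (fr_diff F i).
Local Notation mF i := (idealmul (extgens K n) (Fr i)).

(** The quotient of F_i by [res_ker i] is the i-th syzygy of M, with M itself for i = 0. *)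
Definition res_ker (i : nat) : {pred gfree K n (fr_shift F i)} :=
  match i with
  | 0 => fun x => fr_aug F x == 0
  | k.+1 => fun x => fr_diff F k x == 0
  end.

Arguments res_ker : clear implicits.

Lemma res_kerP i x : reflect (exists y, df i y = x) (x \in res_ker i).
Proof.
case: i x => [|i] x; apply: (iffP eqP).
- by move=> H; apply/(@fr_exact0 _ _ _ F x).
- by move=> H; apply/(@fr_exact0 _ _ _ F x).
- by move=> H; apply/(@fr_exact _ _ _ F i x).
by move=> H; apply/(@fr_exact _ _ _ F i x).
Qed.

Let df_lift i j (g : mon -> Fr i) (P : pred mon) :
  (forall a, homogeneous j (g a)) -> (forall a, P a -> g a \in res_ker i) ->
  exists2 u : mon -> Fr i.+1, forall a, homogeneous j (u a) &
    forall a, P a -> df i (u a) = g a.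
Proof.
move=> gj gk.
suff /choice[u uP] : forall a, exists y, homogeneous j y /\ (P a -> df i y = g a).
  by exists u => a; have [] := uP a.
move=> a; case: (boolP (P a)) => Pa; last by exists 0; split=> //; exact: homog0.
have /res_kerP[y yE] := gk a Pa.
exists (gcomp j y); split=> [|_]; first exact: homog_gcomp.
exact: (degree0_lift (@fr_diff_degree0 _ _ _ F i)).
Qed.

Let df_homog i j x : homogeneous j x -> homogeneous j (df i x).
Proof. exact: fr_diff_degree0. Qed.

(** Vanishing of the kernel of H_b(im d_i) -> H_b(F_i), with d_i = [df i]. It is the target of the
    connecting map, and for b = 0 it is the condition that detects Tor_(i+1). *)
Let boundary_exact b i j := forall z : mon -> Fr i.+1, (forall a, homogeneous j (z a)) ->
  (exists2 g : mon -> Fr i, forall a, homogeneous (j - 1) (g a) &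
    forall a, mdeg a = b -> df i (z a) = chd w g a) ->
  exists2 u, forall a, homogeneous (j - 1) (u a) &
    forall a, mdeg a = b -> df i (z a - chd w u a) = 0.

(** Connecting map of 0 -> im d_i -> F_i -> F_i / im d_i -> 0. It lowers the D-degree and raises the
    M-degree by one, and is injective since F_i is Cartan exact in positive D-degree. *)
Let boundary_exact_chain b i j :
  boundary_exact b i j <-> chain_exact w (res_ker i) b.+1 (j - 1).
Proof.
split=> ex.
  move=> g gj gc.
  have [|a /eqP ab|z zj zE] := @df_lift i j (chd w g) (fun a => mdeg a == b).
  - by move=> a; apply: chd_homog.
  - by apply: gc; rewrite ab.
  have [|u uj uE] := ex z zj; first by exists g => // a ab; apply: zE; apply/eqP.
  have [a|c [cb]|h hj hE] := @gfree_chain_exact _ _ w (fr_shift F i) wB b.+1 (j - 1) isT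
    (fun a => g a - df i (u a)).
  - by apply: homogB => //; apply: df_homog.
  - by rewrite chdB -chd_linear -zE ?cb // -raddfB; apply/eqP/uE.
  exists h => // a ab; have := hE a ab; rewrite inE addrAC subr_eq0 => /eqP ->.
  by apply/res_kerP; exists (u a).
move=> z zj [g gj gE].
have [c [cb]|h hj hE] := ex g gj; first by apply/res_kerP; exists (z c); apply: gE.
have [|a /eqP/hE //|u uj uE] := @df_lift i (j - 1) (fun a => g a - chd w h a) (fun a => mdeg a ==
  b.+1).
  by move=> a; apply: homogB => //; apply: chd_homog.
exists u => // a ab; rewrite raddfB /= gE // chd_linear -chdB.
rewrite (@chd_ext _ _ _ _ _ (chd w h)) ?(chd_chd w1) // => c ca.
by rewrite uE ?ca ?ab // opprB addrC subrK.
Qed.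

(** In D-degree b > 0 every cycle of F_i is a boundary, so the kernel in [boundary_exact] is all of
    the homology. *)
Let chain_boundary_exact b i j : (0 < b)%N ->
  chain_exact w (res_ker i.+1) b j <-> boundary_exact b i j.
Proof.
move=> b0; split=> ex.
  move=> z zj [g gj gE].
  have [c cb|u uj uE] := ex z zj; last by exists u => // a /uE/eqP.
  apply/eqP; rewrite chd_linear (@chd_ext _ _ _ _ _ (chd w g)) ?(chd_chd w1) // => a ac.
  by apply: gE; rewrite ac.
move=> z zj zc.
have [a|c cb|g gj gE] := @gfree_chain_exact _ _ w (fr_shift F i) wB b j b0 (fun a => df i (z a)).
- exact: df_homog.
- by rewrite inE -chd_linear; apply: zc.
have [|u uj uE] := ex z zj.
  by exists g => // a /gE; rewrite inE subr_eq0 => /eqP.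
by exists u => // a /uE/eqP.
Qed.

Let Ktensor_df i (x : Fr i.+1) : Ktensor_map (df i) (qproj (mF i.+1) x) = qproj (mF i) (df i x).
Proof. exact: Ktensor_mapE. Qed.

Let Tor_neq0E i j : Tor_neq0 F i j <-> exists x : Fr i, [/\ homogeneous j x,
  Tor_cycle (qproj (mF i) x : Ktensor (Fr i)) & forall y, x - df i y \notin mF i].
Proof.
split=> [[z [zj zc zb]]|[x [xj xc xb]]].
  exists (gcomp j (repr z)).
  have zE : qproj (mF i) (gcomp j (repr z)) = z by exact: zj.
  split; [exact: homog_gcomp | by rewrite zE | move=> y; apply/negP => xy].
  apply: zb; exists (qproj (mF i.+1) y); rewrite Ktensor_df -zE.
  by apply/esym/qprojE.
exists (qproj (mF i) x); split=> //.
  by rewrite /Defs.homog /= quotcompE ?xj //; exact: idealmul_extgens_graded.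
case=> y; rewrite -(qprojP y) Ktensor_df => /esym/qprojE xy.
by have /negP := xb (repr y).
Qed.

Let boundary_exact_Tor i j : boundary_exact 0 i j <-> ~ Tor_neq0 F i.+1 j.
Proof.
rewrite Tor_neq0E; split=> [ex [x [xj xc xb]]|nT z zj [g gj gE]].
  have dm : df i x \in mF i.
    by move: xc; rewrite /= Ktensor_df -(raddf0 (qproj (mF i))) => /qprojE; rewrite subr0.
  have [g gj gE] := maximal_chd (df_homog xj) dm.
  have [//||u uj uE] := ex (fun=> x).
    by exists g => // a /eqP; rewrite mdeg_eq0 => /eqP ->.
  have /res_kerP[y yE] : x - chd w u 0%MM \in res_ker i.+1 by apply/eqP/uE/mdeg0.
  by have /negP[] := xb y; rewrite yE opprB addrC subrK chd_maximal.
have [y yE] : exists y, z 0%MM - df i.+1 y \in mF i.+1.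
  apply: contrapT => ny; apply: nT; exists (z 0%MM); split=> //.
    rewrite /= Ktensor_df -(raddf0 (qproj (mF i))); apply/qprojE.
    by rewrite subr0 (gE 0%MM mdeg0); exact: (@chd_maximal (Fr i)).
  by move=> y; apply/negP => yE; apply: ny; exists y.
have y'E : z 0%MM - df i.+1 (gcomp j y) \in mF i.+1.
  rewrite (degree0_gcomp (@fr_diff_degree0 _ _ _ F i.+1)) -{1}(zj 0%MM) -gcompB.
  exact: idealmul_extgens_graded.
have [|u uj uE] := @maximal_chd _ j _ _ y'E.
  by apply: homogB => //; apply: df_homog; exact: homog_gcomp.
exists u => // a /eqP; rewrite mdeg_eq0 => /eqP ->.
rewrite -uE opprB addrC subrK; apply/eqP.
by apply/(@res_kerP i.+1); exists (gcomp j y).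
Qed.

Let chain_exact_Tor0 j : chain_exact w (res_ker 0) 0 j <-> ~ Tor_neq0 F 0 j.
Proof.
rewrite Tor_neq0E; split=> [ex [x [xj xc xb]]|nT z zj _].
  have [//|//|u uj uE] := ex (fun=> x).
  have /res_kerP[y yE] := uE 0%MM mdeg0.
  by have /negP[] := xb y; rewrite yE opprB addrC subrK chd_maximal.
have [y yE] : exists y, z 0%MM - df 0 y \in mF 0.
  apply: contrapT => ny; apply: nT; exists (z 0%MM); split=> //.
  by move=> y; apply/negP => yE; apply: ny; exists y.
have y'E : z 0%MM - df 0 (gcomp j y) \in mF 0.
  rewrite (degree0_gcomp (@fr_diff_degree0 _ _ _ F 0)) -{1}(zj 0%MM) -gcompB.
  exact: idealmul_extgens_graded.
have [|u uj uE] := @maximal_chd _ j _ _ y'E.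
  by apply: homogB => //; apply: df_homog; exact: homog_gcomp.
exists u => // a /eqP; rewrite mdeg_eq0 => /eqP ->.
rewrite -uE opprB addrC subrK.
by apply/(@res_kerP 0); exists (gcomp j y).
Qed.

(** Dimension shifting: each step trades one D-degree for one step along F and raises the M-degree
    by one, until D-degree 0 is reached. *)
Let chain_exact_TorS a i j :
  chain_exact w (res_ker i) a.+1 j <-> ~ Tor_neq0 F (i + a.+1) (j + a.+1%:Z).
Proof.
elim: a i j => [|a IH] i j; rewrite -{1}[j](addrK 1) -boundary_exact_chain.
  by rewrite boundary_exact_Tor addn1.
rewrite -chain_boundary_exact // IH addSnnS -addrA.
by rewrite (_ : 1 + _ = a.+2%:Z) // -PoszD.
Qed.

(** The M-degree is the quantity measured by reg, internal degree minus homological degree. The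
    basis w is arbitrary. *)
Lemma chain_exact_Tor i j :
  chain_exact w (pred1 (0 : M)) i j <-> ~ Tor_neq0 F i (j + i%:Z).
Proof.
suff -> : chain_exact w (pred1 (0 : M)) i j <-> chain_exact w (res_ker 0) i j.
  case: i => [|i]; first by rewrite addr0 chain_exact_Tor0.
  exact: (chain_exact_TorS i 0 j).
have augE x j' : homogeneous j' x -> exists y, homogeneous j' y /\ fr_aug F y = x.
  move=> xj; have [y yE] := fr_aug_surj F x.
  exists (gcomp j' y); split; first exact: homog_gcomp.
  exact: (degree0_lift (@fr_aug_degree0 _ _ _ F)).
split=> ex g gj gc.
  have [a|b /gc|h hj hE] := ex (fun a => fr_aug F (g a)).
  - exact: fr_aug_degree0.
  - by rewrite inE -chd_linear.
  have /choice[h' h'E] := fun a => augE _ _ (hj a).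
  exists h' => [a|a /hE]; first exact: (h'E a).1.
  rewrite inE => /eqP aE; apply/eqP; rewrite raddfB /= chd_linear -[RHS]aE.
  by congr (_ - _); apply: chd_ext => b _; exact: (h'E b).2.
have /choice[g' g'E] := fun a => augE _ _ (gj a).
have [a|b /gc|h hj hE] := ex g'; first exact: (g'E a).1.
  rewrite inE => /eqP bE; apply/eqP; rewrite chd_linear -[RHS]bE.
  by apply: chd_ext => c _; exact: (g'E c).2.
exists (fun a => fr_aug F (h a)) => [a|a /hE/eqP]; first exact: fr_aug_degree0.
by rewrite raddfB /= chd_linear (g'E a).2 => aE; apply/eqP.
Qed.

End Resolution.
End TorShift.

(** * Linear injective resolutions *)

Section InjectiveShift.
Variables (K : fieldType) (n : nat).
Local Notation E := (extalg K n).
Local Notation mon := 'X_{1..n}.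
Local Notation ecohd := (cohd (@extgen K n)).

Lemma extcomp_gt_n j (x : E) : n%:Z < j -> extcomp j x = 0.
Proof.
move=> nj; apply/ffunP => A; rewrite !ffunE; case: eqP => // Aj.
by move: nj; rewrite -Aj ltz_nat ltnNge -[X in (_ <= X)%N]card_ord max_card.
Qed.

(** For k outside A the coefficient of x at A reappears up to sign in e_k x, so only the coefficient
    of the top monomial can survive. *)
Lemma extalg_socle j (x : E) : (forall k, extgen K k * x = 0) -> extcomp j x = x ->
  j != n%:Z -> x = 0.
Proof.
move=> ex xj jn; apply/ffunP => A; rewrite ffunE.
have [AT|/existsP[k kA]] := boolP [forall k, k \in A].
  have {AT}-> : A = [set: 'I_n]%SET by apply/setP => k; rewrite inE (forallP AT).
  by rewrite -xj ffunE cardsT card_ord eq_sym (negPf jn).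
have /ffunP/(_ (k |: A)%SET) := ex k.
rewrite extgen_mulE ffunE finset.setU11 finset.setU1K // => /eqP.
by rewrite mulf_eq0 extsign1 // signr_eq0 => /eqP.
Qed.

Lemma gfree_entry s j (x : gfree K n s) (c : 'I_(size s)) :
  homogeneous j x -> extcomp (s`_c + j) ((x : 'rV_(size s)) 0 c) = (x : 'rV_(size s)) 0 c.
Proof. by move=> /(congr1 (fun y : 'rV__ => y 0 c)); rewrite mxE. Qed.

Variables (M : gmod K n) (d : int) (mu : nat -> nat).
Local Notation I i := (gfree K n (nseq (mu i) (n%:Z - d + i%:Z))).
Variable R : min_inj_resolution M (fun i => I i).
Local Notation df i := (ir_diff R i).

(** The shift n - d + i puts the socle of I_i, spanned by top monomials, in degree d - i. *)
Lemma ir_socle i j (x : I i) : homogeneous j x -> (forall k, extgen K k *: x = 0) ->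
  j != d - i%:Z -> x = 0.
Proof.
move=> xj ex jd; apply/rowP => c.
have sc : (nseq (mu i) (n%:Z - d + i%:Z))`_c = n%:Z - d + i%:Z.
  by rewrite nth_nseq; have := ltn_ord c; rewrite {2}size_nseq => ->.
have := gfree_entry c xj; rewrite sc => yj.
rewrite [RHS]mxE; apply: (extalg_socle _ yj) => [k|].
  have := congr1 (fun y : 'rV__ => y 0 c) (ex k).
  by rewrite !mxE.
apply: contra jd => /eqP H; apply/eqP.
by move: H; lia.
Qed.

(** M embeds into I_0, whose part of degree j is a power of E_(n-d+j), zero for j > d. *)
Lemma ir_gt_d j (x : M) : homogeneous j x -> d < j -> x = 0.
Proof.
move=> xj dj; apply: (ir_aug_inj (m := R)); apply: etrans (esym (raddf0 (ir_aug R))).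
have axj : homogeneous j (ir_aug R x : I 0%N) by exact: (@ir_aug_degree0 _ _ _ (fun i => I i) R).
apply/rowP => c; rewrite [RHS]mxE -(gfree_entry c axj) extcomp_gt_n //.
rewrite nth_nseq; have := ltn_ord c; rewrite {2}size_nseq => ->.
by move: dj; lia.
Qed.

Let dfdf i x : df i.+1 (df i x) = 0.
Proof. by apply/(@ir_exact _ _ _ _ R i _); exists x. Qed.

(** Stated for all cosyzygies ker(df k), so that the induction can go up the resolution: i and j
    drop by one, k grows by one, and j != d - k is preserved. In S-degree 0 a cocycle consists of a
    socle element, which lives only in degree d - k. *)
Lemma ir_cochain_exact i : forall k j, j != d - k%:Z ->
  forall y : mon -> I k, (forall a, homogeneous j (y a)) -> (forall a, df k (y a) = 0) ->
  (forall b, mdeg b = i.+1 -> ecohd y b = 0) ->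
  exists z : mon -> I k, [/\ forall a, homogeneous (j - 1) (z a),
    forall a, df k (z a) = 0 & forall a, mdeg a = i -> y a = ecohd z a].
Proof.
elim: i => [|i IH] k j jk y yj yk yc.
  exists (fun=> 0); split=> [a|a|a /eqP]; [exact: homog0 | exact: raddf0 |].
  rewrite mdeg_eq0 => /eqP ->; rewrite [RHS]big1 => [|l _]; last by rewrite scaler0.
  apply: (ir_socle (yj _)) jk => l; have := yc U_(l)%MM (mdeg1 l).
  rewrite /cohd (big_pred1 l) => [|m]; first by rewrite -{1}[U_(l)%MM]add0m addUK.
  by rewrite mnm1E /= eq_sym lt0b.
have wB := cartan_basis_extgen K n; have w1 := wB.1.
have [|b b2|z zj zE] := gfree_cochain_exact (s := nseq (mu k) (n%:Z - d + k%:Z)) (i := i.+1) (j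
  := j) wB _ yj.
- by [].
- by apply/eqP/yc.
pose u a := if mdeg a == i then df k (z a) else 0.
have [|a|a|b bi|w' [w'j w'k w'E]] := IH k.+1 (j - 1) _ u.
- by apply: contra jk => /eqP H; apply/eqP; move: H; lia.
- by rewrite /u; case: ifP => _; [exact: (@ir_diff_degree0 _ _ _ (fun i => I i) R k) | exact:
  homog0].
- by rewrite /u; case: ifP => _; [exact: dfdf | exact: raddf0].
- rewrite (@cohd_ext _ _ _ _ _ (fun a => df k (z a))) => [|c]; last first.
    by rewrite bi => -[ci]; rewrite /u ci eqxx.
  rewrite -cohd_linear; have := zE b bi; rewrite inE subr_eq0 => /eqP <-.
  exact: yk.
have /choice[v vE] : forall a, exists x, homogeneous (j - 1 - 1) x /\ df k x = w' a.
  move=> a; have /(@ir_exact _ _ _ _ R k _)[x xE] := w'k a.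
  exists (gcomp (j - 1 - 1) x); split; first exact: homog_gcomp.
  exact: (degree0_lift (@ir_diff_degree0 _ _ _ (fun i => I i) R k)).
(* z is corrected to lie in the kernel in degree i, the only degree that matters; the value 0 keeps
   it there elsewhere. *)
pose z' (a : mon) := if mdeg a == i then z a - ecohd v a else 0.
exists z'; split=> [a|a|a ai].
- rewrite /z'; case: ifP => _; last exact: homog0.
  by apply: homogB => //; apply: cohd_homog => // b; case: (vE b).
- rewrite /z'; case: eqP => ai; last exact: raddf0.
  rewrite raddfB /= cohd_linear.
  rewrite (@cohd_ext _ _ _ _ _ w') => [|b _]; last exact: (vE b).2.
  by rewrite -w'E // /u ai eqxx subrr.
rewrite (@cohd_ext _ _ _ _ _ (fun a => z a - ecohd v a)) => [|b]; last first.
  by rewrite ai => -[bi]; rewrite /z' bi eqxx.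
rewrite cohdB (cohd_cohd w1) subr0.
by have := zE a ai; rewrite inE subr_eq0 => /eqP.
Qed.

Lemma linear_cochain_exact i j : j < d ->
  cochain_exact (@extgen K n) (pred1 (0 : M)) i j.
Proof.
move=> jd y yj yc.
have [|a|a|b bi|z [zj zk zE]] := @ir_cochain_exact i 0 j _ (fun a => ir_aug R (y a)).
- by rewrite subr0; move: jd; lia.
- exact: (@ir_aug_degree0 _ _ _ (fun i => I i) R).
- by apply/(@ir_exact0 _ _ _ _ R _); exists (y a).
- rewrite -cohd_linear; have := yc b bi; rewrite inE => /eqP ->.
  exact: raddf0.
have /choice[h hE] : forall a, exists x, homogeneous (j - 1) x /\ ir_aug R x = z a.
  move=> a; have /(@ir_exact0 _ _ _ _ R _)[x xE] := zk a.
  exists (gcomp (j - 1) x); split; first exact: homog_gcomp.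
  exact: (degree0_lift (@ir_aug_degree0 _ _ _ (fun i => I i) R)).
exists h => [a|a ai]; first exact: (hE a).1.
rewrite inE subr_eq0; apply/eqP/(ir_aug_inj (m := R)); rewrite zE // cohd_linear.
by apply: cohd_ext => b _; rewrite (hE b).2.
Qed.

End InjectiveShift.

(** * Existence of free resolutions *)

(** U has maximal rank among the matrices whose rows all satisfy P; adjoining a further vector of P
    cannot raise the rank. *)
Lemma rowspace_subspace (K : fieldType) p (P : 'rV[K]_p -> Prop) :
  P 0 -> (forall a u v, P u -> P v -> P (a *: u + v)) ->
  exists U : 'M[K]_p, forall u, P u <-> (u <= U)%MS.
Proof.
move=> P0 PD.
have Pmx (m : nat) (A : 'M[K]_(m, p)) : (forall i, P (row i A)) -> forall u, (u <= A)%MS -> P u.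
  move=> PA u /submxP[c ->]; rewrite mulmx_sum_row.
  elim/big_ind: _ => [//|x y Px Py|i _]; first by rewrite -[x]scale1r; apply: PD.
  by rewrite -[_ *: _]addr0; apply: PD.
pose Q r := `[< exists2 U : 'M[K]_p, (forall i, P (row i U)) & \rank U = r >].
have exQ : exists r, Q r.
  by exists 0%N; apply/asboolP; exists 0; [move=> i; rewrite row0 | exact: mxrank0].
have ubQ r : Q r -> (r <= p)%N by move=> /asboolP[U _ <-]; exact: rank_leq_row.
case: (ex_maxnP exQ ubQ) => r /asboolP[U PU Ur] maxr; exists U => u.
split=> [Pu|]; last exact: Pmx.
have : Q (\rank (U + u)%MS).
  apply/asboolP; exists (U + u)%MS => // i.
  have /sub_addsmxP[[c1 c2] /= ->] := row_sub i (U + u)%MS.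
  rewrite -[c1 *m U]scale1r; apply: (PD); first by apply: (Pmx _ U) => //; exact: submxMl.
  by rewrite [c2]mx11_scalar mul_scalar_mx -[_ *: u]addr0; apply: PD.
move/maxr; rewrite -Ur => le.
by rewrite (submx_trans (addsmxSr U u)) // -(geq_leqif (mxrank_leqif_sup (addsmxSl U u))).
Qed.

Section FreeResolutions.
Variables (K : fieldType) (n : nat).
Local Notation E := (extalg K n).

Definition homog_span (M : gmod K n) (T : finType) (b : T -> M) (deg : T -> int) :=
  (forall t, homogeneous (deg t) (b t)) /\
  forall x, exists c : T -> K, x = \sum_t (c t)%:A *: b t.

Definition finite_dim (M : gmod K n) :=
  exists (T : finType) (b : T -> M) (deg : T -> int), homog_span b deg.

Lemma extalg_monE (x : E) : x = \sum_A ((x A : K)%:A : E) * extmon K A.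
Proof.
apply/ffunP => B; rewrite sum_ffunE (bigD1 B) //= big1 => [|A AB].
  by rewrite -scalerAl mul1r !ffunE eqxx /GRing.scale /= mulr1 addr0.
by rewrite -scalerAl mul1r !ffunE eq_sym (negPf AB) /= scaler0.
Qed.

Lemma extmon_deg (A : {set 'I_n}) : extcomp #|A|%:Z (extmon K A : E) = extmon K A.
Proof.
by apply/ffunP => B; rewrite !ffunE; case: (eqVneq B A) => [->|_]; rewrite ?eqxx ?if_same.
Qed.

Lemma gfree_finite_dim s : finite_dim (gfree K n s).
Proof.
exists ('I_(size s) * {set 'I_n})%type.
exists (fun t => (\row_c if c == t.1 then extmon K t.2 else 0) : 'rV[E]_(size s)).
exists (fun t : 'I_(size s) * {set 'I_n} => #|t.2|%:Z - s`_(t.1)); split=> [[k A]|x].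
  apply/rowP => c; rewrite !mxE; case: eqP => [->|_]; last exact: raddf0.
  by rewrite addrC subrK extmon_deg.
exists (fun t => (x : 'rV_(size s)) 0 t.1 t.2).
apply/rowP => c; rewrite summxE.
transitivity (\sum_k \sum_A (((x : 'rV_(size s)) 0 k A : K)%:A : E) *
    (if c == k then extmon K A else 0)).
  rewrite (bigD1 c) //= [X in _ + X]big1 ?addr0 => [|k kc]; last first.
    by apply: big1 => A _; rewrite eq_sym (negPf kc) mulr0.
  by rewrite {1}[_ 0 c]extalg_monE; apply: eq_bigr => A _; rewrite eqxx.
by rewrite pair_big; apply: eq_bigr => -[k A] _; rewrite !mxE.
Qed.

Section FreeMap.
Variables (M : gmod K n) (s : seq int) (x : 'I_(size s) -> M).

Definition free_map (u : gfree K n s) : M := \sum_k (u : 'rV_(size s)) 0 k *: x k.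

Fact free_map_linear : linear free_map.
Proof.
move=> a u v; rewrite /free_map scaler_sumr -big_split; apply: eq_bigr => k _.
rewrite /= scalerA -scalerDl; congr (_ *: _).
by transitivity ((a *: (u : 'rV_(size s)) + v) 0 k) => //; rewrite !mxE.
Qed.
HB.instance Definition _ := GRing.isLinear.Build E (gfree K n s) M _ free_map free_map_linear.

Lemma free_map_degree0 : (forall k : 'I_(size s), homogeneous (- s`_k) (x k)) -> degree0 free_map.
Proof.
move=> xs j u uj; apply: homog_sum => k _.
rewrite -(gfree_entry k uj) /Defs.homog -{1}[j](subrK (s`_k + j)) [_ - _ + _]addrC gcompZ.
by rewrite -(xs k) gcomp_comp opprD addrCA subrr addr0 eqxx.
Qed.

End FreeMap.

(** The homogeneous components of a K-spanning set of N lie in N and generate it. A component of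
    degree j gets the summand E(-j), whose generator has degree j. *)
Lemma free_cover (M : gmod K n) (N : submodClosed M) : finite_dim M -> graded_submod N ->
  exists s (f : {linear gfree K n s -> M}), degree0 f /\ forall y, y \in N <-> exists x, f x = y.
Proof.
move=> [T [b [deg [_ bE]]]] gN.
pose lin (u : 'rV[K]_#|T|) : M := \sum_t (u 0 (enum_rank t))%:A *: b t.
have linD a u v : lin (a *: u + v) = a%:A *: lin u + lin v.
  rewrite /lin scaler_sumr -big_split; apply: eq_bigr => t _ /=.
  by rewrite !mxE scalerDl scalerA -scalerAl mul1r scalerA scalerDl.
have lin0 : lin 0 = 0 by rewrite /lin big1 // => t _; rewrite mxE !scale0r.
have [||U UE] := @rowspace_subspace K _ (fun u => lin u \in N).
- by rewrite lin0 rpred0.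
- by move=> a u v uN vN; rewrite linD rpredD ?rpredZ.
have /choice[S SE] : forall i, exists s : seq int,
    lin (row i U) = \sum_(j <- s) gcomp j (lin (row i U)).
  by move=> i; have [s _ sE] := gcomp_sum (lin (row i U)); exists s.
pose l := [seq (j, gcomp j (lin (row i U))) | i <- enum 'I_#|T|, j <- S i].
pose s := [seq - p.1 | p <- l].
have sz : size s = size l by rewrite size_map.
pose x (k : 'I_(size s)) := (nth (0, 0) l k).2.
have lP p : p \in l -> homogeneous p.1 p.2 /\ p.2 \in N.
  move=> /allpairsPdep[i [j [_ _ ->]]]; split; first exact: homog_gcomp.
  by apply: gN; apply/UE/row_sub.
have lk (k : 'I_(size s)) : nth (0, 0) l k \in l by apply: mem_nth; rewrite -sz.
exists s, (free_map x); split.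
  apply: free_map_degree0 => k; rewrite (nth_map (0, 0)) -?sz // opprK.
  by have [] := lP _ (lk k).
have imD u v : (exists z, free_map x z = u) -> (exists z, free_map x z = v) ->
    exists z, free_map x z = u + v.
  by move=> [zu <-] [zv <-]; exists (zu + zv); rewrite raddfD.
have imZ a u : (exists z, free_map x z = u) -> exists z, free_map x z = a *: u.
  by move=> [zu <-]; exists (a *: zu); rewrite linearZ.
have im0 : exists z, free_map x z = 0 by exists 0; rewrite raddf0.
have iml p : p \in l -> exists z, free_map x z = p.2.
  move=> pl; have := pl; rewrite -index_mem -sz => pk.
  exists (delta_mx 0 (Ordinal pk) : 'rV[E]_(size s)).
  rewrite /free_map (bigD1 (Ordinal pk)) //= mxE !eqxx scale1r big1 ?addr0 => [|k kp].
    by rewrite /x nth_index.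
  by rewrite mxE (negPf kp) andbF scale0r.
move=> y; split=> [yN|[u <-]]; last first.
  by apply: rpred_sum => k _; rewrite rpredZ //; have [] := lP _ (lk k).
have [c cE] := bE y.
have yE : y = lin (\row_i c (enum_val i)).
  by rewrite cE; apply: eq_bigr => t _; rewrite mxE enum_rankK.
have /UE/submxP[e eE] : lin (\row_i c (enum_val i)) \in N by rewrite -yE.
have linE (m : nat) (F : 'I_m -> 'rV_#|T|) : lin (\sum_i F i) = \sum_i lin (F i).
  by apply: (big_morph lin _ lin0) => u v; rewrite -[u]scale1r linD !scale1r.
rewrite yE eE mulmx_sum_row linE.
elim/big_ind: _ => // i _; rewrite -[_ *: _]addr0 linD lin0 addr0; apply: imZ.
rewrite SE big_seq; elim/big_ind: _ => // j jS; apply: (iml (j, gcomp j (lin (row i U)))).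
by apply/allpairsPdep; exists i, j; rewrite mem_enum.
Qed.

Section Kernel.
Variables (M P : gmod K n) (f : {linear M -> P}).

Fact ker_submod_prop : submod_prop (fun x : M => f x = 0).
Proof. by split=> [|a x y fx fy]; rewrite ?raddf0 // linearP fx fy scaler0 addr0. Qed.

Lemma ker_graded : degree0 f -> graded_submod (propsub ker_submod_prop).
Proof.
move=> f0 j x /asboolP fx; apply/asboolP.
by rewrite (degree0_gcomp f0) fx gcomp0.
Qed.

End Kernel.

(** Packaging for a construction by plain iteration: the target of each step is by definition the
    source of the one before. *)
Record res_step := ResStep {
  step_src : seq int;
  step_tgt : seq int;
  step_map : {linear gfree K n step_src -> gfree K n step_tgt};
  step_degree0 : degree0 step_map
}.

Lemma res_next (S : res_step) : exists s (g : {linear gfree K n s -> gfree K n (step_src S)}),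
  degree0 g /\ exact_at g (step_map S).
Proof.
have [s [g [g0 gE]]] := free_cover (gfree_finite_dim _) (ker_graded (@step_degree0 S)).
by exists s, g; split=> // y; rewrite -gE; split=> /asboolP.
Qed.

Lemma free_resolution_exists (M : gmod K n) : finite_dim M -> inhabited (free_resolution M).
Proof.
move=> Mfin.
have topP : submod_prop (fun _ : M => True) by [].
have [|s0 [aug [aug0 augE]]] := @free_cover M (propsub topP) Mfin.
  by move=> j x _; apply/asboolP.
have [s1 [g [g0 gE]]] := free_cover (gfree_finite_dim _) (ker_graded aug0).
have nextT S : {s & {h : {linear gfree K n s -> gfree K n (step_src S)} |
    degree0 h /\ exact_at h (step_map S)}}.
  by have [s /cid[h hP]] := cid (res_next S); exists s, h.
pose nx S := ResStep (svalP (projT2 (nextT S))).1.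
pose St i := iter i nx (ResStep g0).
constructor.
apply: (@FreeResolution _ _ M (fun i => step_tgt (St i)) aug (fun i => step_map (St i))) => //.
- by move=> i; exact: step_degree0.
- by move=> y; have [x xE] := (augE y).1 (asboolT I); exists x.
- by move=> y; rewrite -gE; split=> /asboolP.
by move=> i; exact: (svalP (projT2 (nextT (St i)))).2.
Qed.

End FreeResolutions.

(** * Polynomials and fractions *)

Lemma digits_inj n B (m m' : 'I_n -> nat) :
  (forall i, m i < B)%N -> (forall i, m' i < B)%N ->
  (\sum_i m i * B ^ i = \sum_i m' i * B ^ i)%N -> m =1 m'.
Proof.
elim: n m m' => [|n IH] m m' mB m'B; first by move=> _ [].
have B0 : (0 < B)%N by apply: leq_ltn_trans (mB ord0).
have shift (u : 'I_n.+1 -> nat) :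
    (\sum_i u i * B ^ i = u ord0 + (\sum_(i < n) u (lift ord0 i) * B ^ i) * B)%N.
  rewrite big_ord_recl expn0 muln1 big_distrl; congr addn; apply: eq_bigr => i _.
  by rewrite lift0 expnSr mulnA.
rewrite !shift => E0.
have e0 : m ord0 = m' ord0.
  by have := congr1 (modn^~ B) E0; rewrite ![(_ + _ * B)%N]addnC !modnMDl !modn_small.
move: E0; rewrite e0 => /addnI/eqP; rewrite eqn_pmul2r // => /eqP/IH eS i.
by case: (unliftP ord0 i) => [j ->|->//]; apply: eS => j'.
Qed.

Lemma poly_nonroot (K : fieldType) (p : {poly K}) :
  infinite_set [set: K]%classic -> p != 0 -> exists t, p.[t] != 0.
Proof.
move=> Kinf p0; apply: contrapT => np.
have [B _ sB] := infinite_set_fset (size p) Kinf.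
have allB : all (root p) (finmap.enum_fset B).
  by apply/allP => t _; apply/negP => /negP t0; apply: np; exists t.
by have := max_poly_roots p0 allB (finmap.fset_uniq B); rewrite ltnNge sB.
Qed.

(** Kronecker substitution x_i = t^(B^i): B exceeds all exponents of p, so distinct monomials become
    distinct powers of t and p becomes a nonzero polynomial in one variable. *)
Lemma mpoly_nonroot (K : fieldType) n (p : {mpoly K[n]}) :
  infinite_set [set: K]%classic -> p != 0 -> exists c : 'I_n -> K, p.@[c] != 0.
Proof.
move=> Kinf p0; set B := msize p.
pose e (m : 'X_{1..n}) := (\sum_i m i * B ^ i)%N.
pose q : {poly K} := \sum_(m <- msupp p) p@_m *: 'X^(e m).
have mB m i : m \in msupp p -> (m i < B)%N.
  move=> /msize_mdeg_lt; apply: leq_trans; rewrite ltnS mdegE (bigD1 i) //=.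
  exact: leq_addr.
have e_inj : {in msupp p &, injective e}.
  move=> m m' mp m'p /digits_inj mm'; apply/mnmP => i; apply: mm' => j; exact: mB.
have [m0 m0p] : exists m, m \in msupp p.
  case E : (msupp p) => [|m s]; last by exists m; rewrite mem_head.
  by move: p0; rewrite -msupp_eq0 E.
have q0 : q != 0.
  apply/eqP => /(congr1 (fun r : {poly K} => r`_(e m0))); rewrite coef0 coef_sum.
  rewrite (bigD1_seq m0) ?msupp_uniq //= coefZ coefXn eqxx mulr1 big1_seq => [|m /andP[mm0 mp]].
    by rewrite addr0 => /eqP; apply/negP; rewrite -mcoeff_msupp.
  rewrite coefZ coefXn; case: eqP => [/e_inj em|_]; last by rewrite mulr0.
  by rewrite em ?eqxx in mm0.
have [t qt] := poly_nonroot Kinf q0.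
exists (fun i : 'I_n => t ^+ (B ^ i)); rewrite mevalE.
suff -> : \sum_(m <- msupp p) p@_m * \prod_(i < n) (t ^+ (B ^ i)) ^+ m i = q.[t] by [].
rewrite horner_sum; apply: eq_bigr => m _; rewrite hornerZ hornerXn; congr (_ * _).
rewrite /e expr_sum; apply: eq_bigr => i _.
by rewrite -exprM mulnC.
Qed.

Lemma fraction_denom (R : idomainType) (x : {fraction R}) :
  exists p q : R, q != 0 /\ tofrac q * x = tofrac p.
Proof.
elim/quotW: x => r; exists (frac r).1, (frac r).2; split; first exact: denom_ratioP.
unlock tofrac; rewrite -[LHS]FracField.pi_mul; apply/eqmodP.
rewrite /= FracField.equivfE /FracField.mulf !numden_Ratio ?mulf_neq0 ?oner_neq0 ?denom_ratioP //.
by rewrite mulr1 mul1r.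
Qed.

Lemma matrix_denom (R : idomainType) m p (Z : 'M[{fraction R}]_(m, p)) :
  exists (q : R) (Z' : 'M[R]_(m, p)), q != 0 /\ map_mx (@tofrac R) Z' = tofrac q *: Z.
Proof.
have /choice[N /choice[D ND]] := fun t : 'I_m * 'I_p => fraction_denom (Z t.1 t.2).
exists (\prod_t D t), (\matrix_(i, j) (N (i, j) * \prod_(t | t != (i, j)) D t)).
split; first by apply/prodf_neq0 => t _; have [] := ND t.
apply/matrixP => i j; rewrite !mxE [X in _ = tofrac X * _](bigD1 (i, j)) //=.
by rewrite [LHS]tofracM [X in _ = X * _]tofracM -(ND (i, j)).2 mulrAC.
Qed.

Lemma mcoeffXM (R : comNzRingType) n (p : {mpoly R[n]}) k (a : 'X_{1..n}) :
  ('X_k * p)@_a = if (0 < a k)%N then p@_(a - U_(k)) else 0.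
Proof.
rewrite mulrC; case: ifP => ak.
  by rewrite -{1}(subUK ak) addmC mcoeffMX.
rewrite [p]mpolyE mulr_suml raddf_sum big1 // => m _ /=.
rewrite -scalerAl mcoeffZ -mpolyXD mcoeffX; case: eqP => [am|_]; last by rewrite mulr0.
by move: ak; rewrite -am mnmDE mnm1E eqxx addn1.
Qed.

Lemma mdeg_enum n i : exists s : seq 'X_{1..n}, uniq s /\ forall a, (a \in s) = (mdeg a == i).
Proof.
exists [seq bmnm a | a : 'X_{1..n < i.+1} in [pred a | mdeg (bmnm a) == i]].
split; first by rewrite map_inj_uniq ?enum_uniq //; exact: val_inj.
move=> a; apply/mapP/eqP => [[b]|ai]; first by rewrite mem_enum inE => /eqP ? ->.
have ai' : (mdeg a < i.+1)%N by rewrite ai.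
by exists (BMultinom ai') => //; rewrite mem_enum inE /= ai.
Qed.

(** * Constructing a regular element *)

Section Coordinates.
Variables (K : fieldType) (n : nat) (M : gmod K n) (N : submodClosed M).
Local Notation E := (extalg K n).
Local Notation mon := 'X_{1..n}.

Definition lincomb m (b : 'I_m -> M) (c : 'rV[K]_m) : M := \sum_i (c 0 i)%:A *: b i.

Lemma lincombP m (b : 'I_m -> M) a u v :
  lincomb b (a *: u + v) = a%:A *: lincomb b u + lincomb b v.
Proof.
rewrite /lincomb scaler_sumr -big_split; apply: eq_bigr => t _ /=.
by rewrite !mxE scalerDl scalerA -scalerAl mul1r scalerA scalerDl.
Qed.

Lemma lincomb0 m (b : 'I_m -> M) : lincomb b 0 = 0.
Proof. by rewrite /lincomb big1 // => t _; rewrite mxE !scale0r. Qed.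

Lemma lincombD m (b : 'I_m -> M) u v : lincomb b (u + v) = lincomb b u + lincomb b v.
Proof. by rewrite -[u]scale1r lincombP !scale1r. Qed.

Lemma lincombZ m (b : 'I_m -> M) a u : lincomb b (a *: u) = a%:A *: lincomb b u.
Proof. by rewrite -[a *: u]addr0 lincombP lincomb0 addr0. Qed.

Lemma lincombB m (b : 'I_m -> M) u v : lincomb b (u - v) = lincomb b u - lincomb b v.
Proof. by rewrite lincombD -[- v]scaleN1r lincombZ scaleN1r scaleNr scale1r. Qed.

Lemma lincomb_sum m (b : 'I_m -> M) I (r : seq I) (F : I -> 'rV_m) :
  lincomb b (\sum_(i <- r) F i) = \sum_(i <- r) lincomb b (F i).
Proof. exact: (big_morph _ (@lincombD m b) (lincomb0 b)). Qed.

(** A homogeneous family of least size that spans M modulo N is independent: a relation would allow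
    one member to be dropped. *)
Lemma homog_basis : finite_dim M ->
  exists m (b : 'I_m -> M) (deg : 'I_m -> int),
    [/\ forall i, homogeneous (deg i) (b i),
        forall x, exists c, x - lincomb b c \in N &
        forall c, lincomb b c \in N -> c = 0].
Proof.
move=> [T [b0 [deg0 [b0j b0s]]]].
pose P m := `[< exists (b : 'I_m -> M) (deg : 'I_m -> int),
    (forall i, homogeneous (deg i) (b i)) /\
    forall x, exists c, x - lincomb b c \in N >].
have exP : exists m, P m.
  exists #|T|; apply/asboolP; exists (fun i => b0 (enum_val i)), (fun i => deg0 (enum_val i)).
  split=> [i|x]; first exact: b0j.
  have [c cE] := b0s x; exists (\row_i c (enum_val i)).
  rewrite cE /lincomb (reindex (@enum_val T predT)) /=; last first.
    by apply: onW_bij; exact: enum_val_bij.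
  by rewrite [X in _ - X](eq_bigr (fun i => (c (enum_val i))%:A *: b0 (enum_val i))) ?subrr
    ?rpred0 // => i _; rewrite mxE.
case: (ex_minnP exP) => m /asboolP[b [deg [bj bs]]] minm.
exists m, b, deg; split=> // c cN; apply/rowP => i0; rewrite mxE; apply/eqP/negPn/negP => ci0.
case: m => [|m] in b deg bj bs minm c i0 cN ci0 *; first by case: i0 ci0.
suff /minm : P m by rewrite ltnn.
apply/asboolP; exists (fun j => b (lift i0 j)), (fun j => deg (lift i0 j)); split=> // x.
have [a aE] := bs x.
(* Subtracting a multiple of the relation c changes the element only by N and clears the coordinate
   i0. *)
pose a' := a - (a 0 i0 / c 0 i0) *: c.
have a'0 : a' 0 i0 = 0 by rewrite !mxE divfK ?subrr.
exists (\row_j a' 0 (lift i0 j)).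
have -> : lincomb (fun j => b (lift i0 j)) (\row_j a' 0 (lift i0 j)) = lincomb b a'.
  rewrite /lincomb [RHS](bigD1_ord i0) //= a'0 !scale0r add0r.
  by apply: eq_bigr => j _; rewrite mxE.
by rewrite lincombB lincombZ opprB addrA addrAC rpredD // rpredZ.
Qed.

Variables (m : nat) (b : 'I_m -> M) (deg : 'I_m -> int) (co : M -> 'rV[K]_m).
Local Notation lin := (lincomb b).
Hypothesis gN : graded_submod N.
Hypothesis bj : forall i, homogeneous (deg i) (b i).
Hypothesis bI : forall c, lin c \in N -> c = 0.
Hypothesis coE : forall x, x - lin (co x) \in N.

Lemma coP x c : x - lin c \in N -> co x = c.
Proof.
move=> xc; apply/eqP; rewrite -subr_eq0; apply/eqP/bI; rewrite lincombB.
have -> : lin (co x) - lin c = (x - lin c) - (x - lin (co x)).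
  by rewrite opprB [RHS]addrC addrA subrK.
exact: submodB.
Qed.

Lemma co_lin c : co (lin c) = c.
Proof. by apply: coP; rewrite subrr rpred0. Qed.

Lemma coN x : x \in N <-> co x = 0.
Proof.
split=> [xN|x0]; first by apply: coP; rewrite lincomb0 subr0.
by have := coE x; rewrite x0 lincomb0 subr0.
Qed.

Lemma coD x y : co (x + y) = co x + co y.
Proof. by apply: coP; rewrite lincombD opprD addrACA rpredD. Qed.

Lemma coB x y : co (x - y) = co x - co y.
Proof. by apply: coP; rewrite lincombB opprD addrACA -opprD submodB. Qed.

Lemma co_eq x y : x - y \in N <-> co x = co y.
Proof. by rewrite coN coB; split=> [/eqP|->]; rewrite ?subrr // subr_eq0 => /eqP. Qed.

Lemma co_sum I (r : seq I) (Q : pred I) (F : I -> M) :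
  co (\sum_(i <- r | Q i) F i) = \sum_(i <- r | Q i) co (F i).
Proof. by apply: (big_morph _ coD); apply/coN; rewrite rpred0. Qed.

Definition comx (v : E) : 'M[K]_m := \matrix_(i < m) co (v *: b i).

Lemma co_mul v x : co (v *: x) = co x *m comx v.
Proof.
apply: coP; have -> : v *: x = v *: (x - lin (co x)) + v *: lin (co x).
  by rewrite -scalerDr subrK.
rewrite -addrA rpredD ?rpredZ //.
rewrite mulmx_sum_row lincomb_sum scaler_sumr -sumrB; apply: rpred_sum => i _.
rewrite lincombZ rowK scalerA.
have -> : v * (co x 0 i)%:A = (co x 0 i)%:A * v by rewrite -scalerAl -scalerAr mulr1 mul1r.
rewrite -scalerA -scalerBr.
by rewrite rpredZ.
Qed.

Lemma co_homog j x i : homogeneous j x -> co x 0 i != 0 -> deg i = j.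
Proof.
move=> xj; pose c := \row_l (if deg l == j then co x 0 l else 0).
have -> : co x = c.
  apply: coP; have := gN j (coE x); rewrite gcompB xj gcomp_bigsum.
  rewrite (eq_bigr (fun l => (c 0 l)%:A *: b l)) // => l _.
  by rewrite gcomp_scal (gcomp_homog _ (bj l)) mxE eq_sym; case: ifP; rewrite // scaler0 !scale0r.
by rewrite mxE; case: (eqVneq (deg i) j) => //; rewrite eqxx.
Qed.

Lemma lin_homog j (c : 'rV[K]_m) : (forall i, c 0 i != 0 -> deg i = j) -> homogeneous j (lin c).
Proof.
move=> cj; apply: homog_sum => i _; have [->|/cj <-] := eqVneq (c 0 i) 0.
  by rewrite !scale0r; exact: homog0.
exact: homog_scal.
Qed.

Lemma comx_deg v i l : extcomp 1 v = v -> comx v i l != 0 -> deg l = deg i + 1.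
Proof. by move=> v1; rewrite mxE; apply: co_homog; apply: homogZ1'. Qed.

Section Polynomials.
Variable w : 'I_n -> E.
Hypothesis w1 : forall k, extcomp 1 (w k) = w k.
Local Notation S := {mpoly K[n]}.
Local Notation A k := (comx (w k)).

(** The differential of (M/N) (x) S in coordinates; elements are rows, so it acts by multiplication
    on the right. *)
Definition cartan_mx : 'M[S]_m := \sum_k 'X_k *: map_mx (@mpolyC n K) (A k).
Local Notation D := cartan_mx.

Lemma cartan_mxE i l : D i l = \sum_k 'X_k * (A k i l)%:MP_[n].
Proof. by rewrite summxE; apply: eq_bigr => k _; rewrite !mxE. Qed.

Lemma cartan_mx_deg i l : deg l != deg i + 1 -> D i l = 0.
Proof.
move=> il; rewrite cartan_mxE big1 // => k _.
have [->|H] := eqVneq (A k i l) 0; first by rewrite mpolyC0 mulr0.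
by rewrite (comx_deg (w1 k) H) eqxx in il.
Qed.

Lemma cartan_mx_deg_neq0 i l : D i l != 0 -> deg l = deg i + 1.
Proof. by move=> Dil; apply/eqP; apply: contraNT Dil => /cartan_mx_deg ->. Qed.

Lemma cartan_mx_sqr : D *m D = 0.
Proof.
rewrite /D mulmx_suml.
under eq_bigr do rewrite mulmx_sumr.
have AA k l i : row i (A k *m A l) = co (w l *: (w k *: b i)).
  by rewrite row_mul rowK -co_mul.
apply: sum_alternating => [k|k l]; rewrite -!scalemxAl -!scalemxAr -!map_mxM.
  rewrite (_ : A k *m A k = 0) ?map_mx0 ?scaler0 //.
  apply/row_matrixP => i; rewrite AA row0 scalerA deg1_sqr // scale0r.
  by apply/coN; rewrite rpred0.
rewrite (_ : A k *m A l = - (A l *m A k)).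
  by rewrite map_mxN !scalerN !scalerA mulrC.
apply/row_matrixP => i; rewrite AA linearN /= AA !scalerA deg1_anticomm // scaleNr.
by rewrite -[X in co X]add0r coB (iffLR (coN 0) (rpred0 N)) sub0r.
Qed.

Definition cf r p (a : mon) (Y : 'M[S]_(r, p)) : 'M[K]_(r, p) := map_mx (mcoeff a) Y.

Lemma cf_mulD r (Y : 'M[S]_(r, m)) a :
  cf a (Y *m D) = \sum_(k | (0 < a k)%N) cf (a - U_(k))%MM Y *m A k.
Proof.
apply/matrixP => i l; rewrite summxE !mxE raddf_sum.
transitivity (\sum_k \sum_s if (0 < a k)%N then (Y i s)@_(a - U_(k)) * A k s l else 0).
  rewrite exchange_big; apply: eq_bigr => s _ /=; rewrite cartan_mxE mulr_sumr raddf_sum.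
  apply: eq_bigr => k _ /=; rewrite mulrCA mcoeffXM; case: ifP => // _.
  by rewrite mulrC mcoeffCM mulrC.
rewrite [RHS]big_mkcond; apply: eq_bigr => k _; case: ifP => _; last by rewrite big1.
by rewrite [RHS]mxE; apply: eq_bigr => s _; congr (_ * _); rewrite mxE.
Qed.

Lemma co_cohd (g : mon -> M) a :
  co (cohd w g a) = \sum_(k | (0 < a k)%N) co (g (a - U_(k))%MM) *m A k.
Proof. by rewrite co_sum; apply: eq_bigr => k _; rewrite co_mul. Qed.

Lemma co_chd (g : mon -> M) a :
  co (chd w g a) = \sum_k co (g (a + U_(k))%MM) *m A k.
Proof. by rewrite co_sum; apply: eq_bigr => k _; rewrite co_mul. Qed.

Lemma cf_inj r p (X Y : 'M[S]_(r, p)) : (forall a, cf a X = cf a Y) -> X = Y.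
Proof.
move=> XY; apply/matrixP => i l; apply/mpolyP => a.
by have := congr1 (fun Z : 'M__ => Z i l) (XY a); rewrite !mxE.
Qed.

Definition row_deg (j : int) (y : 'rV[S]_m) := forall i, y 0 i != 0 -> deg i = j.

(** [cochain_exact] solves one S-degree at a time. Since y is polynomial, finitely many of these
    solutions combine to a polynomial row z. *)
Lemma cartan_mx_exact j (y : 'rV[S]_m) : (forall i, cochain_exact w N i j) ->
  row_deg j y -> y *m D = 0 -> exists2 z, y = z *m D & row_deg (j - 1) z.
Proof.
move=> ex yj yD.
pose g a := lin (cf a y).
have gj a : homogeneous j (g a).
  apply: lin_homog => i; rewrite mxE => ya; apply: yj.
  by apply: contraNneq ya => ->; rewrite mcoeff0.
have gc a : cohd w g a \in N.
  apply/coN; rewrite co_cohd; under eq_bigr do rewrite co_lin.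
  by rewrite -cf_mulD yD; apply/matrixP => i l; rewrite !mxE mcoeff0.
have /choice[h hP] : forall i, exists h : mon -> M, (forall a, homogeneous (j - 1) (h a)) /\
    forall a, mdeg a = i -> g a - cohd w h a \in N.
  by move=> i; have [//|h hj hE] := ex i g gj; exists h.
pose B := \max_(i < m) msize (y 0%R i).
have yB a : (B <= mdeg a)%N -> cf a y = 0.
  move=> Ba; apply/matrixP => i l; rewrite !mxE; apply: memN_msupp_eq0.
  apply: msize_mdeg_ge; apply: leq_trans Ba.
  by rewrite ord1 (leq_bigmax l).
(* The coefficient at a comes from the solution for S-degree |a| + 1, the degree to which the
   differential carries it. *)
pose z : 'rV[S]_m := \row_l \sum_(a : 'X_{1..n < B}) co (h (mdeg a).+1 a) 0 l *: 'X_[a].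
have zE a : cf a z = if (mdeg a < B)%N then co (h (mdeg a).+1 a) else 0.
  apply/rowP => l; rewrite !mxE; case: ltnP => aB.
    by rewrite (mcoeff_mpoly (fun a => co (h (mdeg a).+1 a) 0 l)).
  rewrite raddf_sum mxE big1 // => a' _ /=; rewrite mcoeffZ mcoeffX.
  case: eqP => [aa|_]; last by rewrite mulr0.
  by have := bmdeg a'; rewrite aa ltnNge aB.
exists z.
  apply: cf_inj => a; rewrite cf_mulD.
  have [aB|aB] := leqP (mdeg a) B; last first.
    rewrite yB ?(ltnW aB) // big1 // => k ak; rewrite zE -[X in if X then _ else _]ltnS.
    by rewrite mdeg_subU // ltnNge aB mul0mx.
  transitivity (co (g a)); first by rewrite co_lin.
  rewrite (iffLR (co_eq _ _) ((hP (mdeg a)).2 a erefl)) co_cohd; apply: eq_bigr => k ak.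
  rewrite zE -[X in if X then _ else _]ltnS mdeg_subU // ltnS aB.
  by [].
move=> l; apply: contraNeq => lj; rewrite mxE big1 // => a _.
have [->|/co_homog H] := eqVneq (co (h (mdeg a).+1 a) 0 l) 0; first by rewrite scale0r.
by rewrite (H (j - 1)) ?eqxx // in lj; exact: (hP _).1.
Qed.

Lemma cf_Dmul r (Y : 'M[S]_(m, r)) a :
  cf a (D *m Y) = \sum_(k | (0 < a k)%N) A k *m cf (a - U_(k))%MM Y.
Proof.
apply/matrixP => i l; rewrite summxE !mxE raddf_sum.
transitivity (\sum_k \sum_s if (0 < a k)%N then A k i s * (Y s l)@_(a - U_(k)) else 0).
  rewrite exchange_big; apply: eq_bigr => s _ /=; rewrite cartan_mxE mulr_suml raddf_sum.
  apply: eq_bigr => k _ /=; rewrite -mulrA mcoeffXM; case: ifP => // _.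
  by rewrite mcoeffCM.
rewrite [RHS]big_mkcond; apply: eq_bigr => k _; case: ifP => _; last by rewrite big1.
by rewrite [RHS]mxE; apply: eq_bigr => s _; congr (_ * _); rewrite mxE.
Qed.

Lemma lin_delta i : lin (delta_mx 0 i) = b i.
Proof.
rewrite /lincomb (bigD1 i) //= mxE !eqxx !scale1r big1 ?addr0 // => l li.
by rewrite mxE (negPf li) andbF !scale0r.
Qed.

Variable d0 : int.
Hypothesis top : forall j x, homogeneous j x -> d0 < j -> x \in N.
Hypothesis rex : forall i, chain_exact w N i d0.

(* A relation D l = 0 gives a functional on the families of degree d0 that kills
   all boundaries, so that it vanishes there. *)
Lemma cartan_mx_coker (l : 'cV[S]_m) i : D *m l = 0 -> deg i = d0 -> l i 0 = 0.
Proof.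
move=> Dl di; apply/mpolyP => al; rewrite mcoeff0.
(* The family b_i x^(al). It is a cycle because its boundary lies above the top degree d0, hence
   [rex] makes it a boundary. *)
pose g a := if a == al then b i else 0.
have gj a : homogeneous d0 (g a) by rewrite /g; case: eqP => // _; [rewrite -di | exact: homog0].
have [a _|h hj hE] := @rex (mdeg al) g gj.
  by apply: (top (j := d0 + 1)); rewrite ?ltrDl //; apply: chd_homog => // c; rewrite addrK.
have [s [us sE]] := mdeg_enum n (mdeg al).
have [t [ut tE]] := mdeg_enum n (mdeg al).+1.
(* Terms of the pairing of families with columns over S. Under it [chd] is adjoint to left
   multiplication by D, so boundaries pair to zero with l. *)
pose G k c := co (h c) *m (A k *m cf (c - U_(k))%MM l).
have gE : \sum_(a <- s) co (g a) *m cf a l = row i (cf al l).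
  rewrite (bigD1_seq al) ?sE //= big1 ?addr0 => [|a aal]; rewrite /g.
    by rewrite eqxx -(lin_delta i) co_lin rowE.
  by rewrite (negPf aal) (iffLR (coN 0) (rpred0 N)) mul0mx.
have hE0 : \sum_(a <- s) co (g a) *m cf a l = 0.
  transitivity (\sum_(a <- s) \sum_k G k (a + U_(k))%MM).
    rewrite big_seq [RHS]big_seq; apply: eq_bigr => a; rewrite sE => /eqP a1.
    rewrite (iffLR (co_eq _ _) (hE a a1)) co_chd mulmx_suml; apply: eq_bigr => k _.
    by rewrite /G addUK mulmxA.
  rewrite exchange_big /=.
  transitivity (\sum_k \sum_(c <- t | (0 < c k)%N) G k c).
    apply: eq_bigr => k _; rewrite -[RHS]big_filter -[LHS](big_map (fun a => (a + U_(k))%MM)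
      xpredT (G k)).
    apply: perm_big; apply: uniq_perm; rewrite ?filter_uniq //.
      by rewrite map_inj_uniq // => x y /(congr1 (fun c => (c - U_(k))%MM)); rewrite !addUK.
    move=> c; rewrite mem_filter tE; apply/mapP/andP => [[a]|[ck /eqP c1]].
      by rewrite sE => /eqP a1 ->; rewrite mnmDE mnm1E eqxx addn1 mdegD mdeg1 addn1 a1.
    by exists (c - U_(k))%MM; rewrite ?subUK // sE -eqSS mdeg_subU // c1.
  rewrite (exchange_big_dep predT) //= big1 // => c _.
  by rewrite -mulmx_sumr -cf_Dmul Dl [cf _ _](_ : _ = 0) ?mulmx0 //; apply/matrixP => x y;
    rewrite !mxE mcoeff0.
by have := congr1 (fun Y : 'M_1 => Y 0 0) gE; rewrite hE0 !mxE.
Qed.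

Local Notation P := (diag_mx (\row_i (deg i == d0)%:R) : 'M[S]_m).

(** Over the fraction field, the row space of D contains that of P once every column killed by D is
    killed by P, which [cartan_mx_coker] gives after clearing denominators. Clearing them again in
    the solution produces q. *)
Lemma cartan_mx_top : exists (q : S) (Z : 'M[S]_m), q != 0 /\ Z *m D = q *: P.
Proof.
pose F := {fraction S}; pose f := @tofrac S.
have f_inj p r (X Y : 'M[S]_(p, r)) : map_mx f X = map_mx f Y -> X = Y.
  move=> XY; apply/matrixP => i j; have := congr1 (fun Z : 'M__ => Z i j) XY.
  by rewrite !mxE => /eqP; rewrite tofrac_eq => /eqP.
have PD : (map_mx f P <= map_mx f D)%MS.
  rewrite submxE; have [q [C [q0 CE]]] := matrix_denom (cokermx (map_mx f D)).
  have DC : D *m C = 0.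
    by apply: f_inj; rewrite map_mxM CE -scalemxAr mulmx_coker scaler0 map_mx0.
  have PC : P *m C = 0.
    apply/matrixP => i j; rewrite mul_diag_mx !mxE; case: eqP => [di|_]; last by rewrite mul0r.
    have := @cartan_mx_coker (col j C) i; rewrite {1}colE mulmxA DC mul0mx mxE => -> //.
    by rewrite mulr0.
  have : map_mx f P *m (tofrac q *: cokermx (map_mx f D)) = 0 by rewrite -CE -map_mxM PC map_mx0.
  rewrite -scalemxAr => /eqP; rewrite scalemx_eq0 tofrac_eq0 (negPf q0) //.
have [q [Z [q0 ZE]]] := matrix_denom (map_mx f P *m pinvmx (map_mx f D)).
exists q, Z; split=> //; apply: f_inj.
by rewrite map_mxM ZE -scalemxAl mulmxKpV // map_mxZ.
Qed.

Hypothesis lex : forall i j, j < d0 -> cochain_exact w N i j.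

(** H is built row by row, downwards from degree d0. D raises degrees by one, so row i of D H
    involves only rows already built, and row i of H must solve z D = q e_i - (row i of D H). In
    degree d0 the solution comes from Z, below it from exactness. *)
Lemma cartan_mx_homotopy : exists (q : S) (H : 'M[S]_m), q != 0 /\ D *m H + H *m D = q%:M.
Proof.
have [q [Z [q0 ZE]]] := cartan_mx_top; exists q.
have degD i : deg i <= d0.
  rewrite leNgt; apply/negP => /(top (bj i)); rewrite -lin_delta => /bI.
  by move/matrixP/(_ 0 i); rewrite !mxE !eqxx => /eqP; rewrite oner_eq0.
suff step s : exists H : 'M[S]_m, forall i, d0 - s%:Z < deg i ->
    row i (D *m H + H *m D) = row i q%:M /\ row_deg (deg i - 1) (row i H).
  pose s := (\max_i `|d0 - deg i|.+1)%N.
  have [H HE] := step s; exists H; split=> //; apply/row_matrixP => i.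
  apply: (HE i _).1; have := leq_bigmax (F := fun i => `|d0 - deg i|.+1) i.
  by rewrite -/s; have := degD i; lia.
elim: s => [|s [H HE]].
  by exists 0 => i; rewrite subr0 ltNge degD.
have Dr i r : d0 - s%:Z <= deg i -> D i r != 0 ->
    row r (D *m H + H *m D) = row r q%:M /\ row_deg (deg r - 1) (row r H).
  move=> di Dir; apply: HE; have ->: deg r = deg i + 1 by exact: cartan_mx_deg_neq0.
  by move: di; lia.
have /choice[z zE] : forall i, exists z : 'rV[S]_m, deg i = d0 - s%:Z ->
    z *m D = row i q%:M - row i (D *m H) /\ row_deg (deg i - 1) z.
  move=> i; have [di|di] := eqVneq (deg i) (d0 - s%:Z); last by exists 0 => e; rewrite e eqxx in di.
  have dile : d0 - s%:Z <= deg i by rewrite di.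
  have [dd|dd] := eqVneq (deg i) d0.
    (* Only the entries of Z that lower the degree by one are kept; the others do not contribute to
       the columns of degree d0. *)
    exists (\row_l if deg l == deg i - 1 then Z i l else 0) => _; split; last first.
      by move=> l; rewrite mxE; case: (eqVneq (deg l) _) => //; rewrite eqxx.
    have -> : row i (D *m H) = 0.
      apply/rowP => l; rewrite !mxE big1 // => r _; rewrite cartan_mx_deg ?mul0r //.
      by have := degD r; rewrite dd; lia.
    rewrite subr0; apply/rowP => l; rewrite !mxE.
    transitivity ((deg l == d0)%:R * (Z *m D) i l).
      rewrite mxE mulr_sumr; apply: eq_bigr => r _; rewrite mxE.
      have [lr|lr] := eqVneq (deg l) (deg r + 1); last by rewrite cartan_mx_deg ?mulr0.
      rewrite lr dd [deg r + 1 == d0](_ : _ = (deg r == d0 - 1)).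
        by case: ifP => _; rewrite ?mul1r ?mul0r.
      by rewrite -subr_eq opprK.
    rewrite ZE !mxE; have [il|il] := eqVneq i l; last by rewrite !mulr0n !mulr0.
    by rewrite -il dd eqxx !mulr1n mulr1 mul1r.
  pose y := row i q%:M - row i (D *m H).
  have yj : row_deg (deg i) y.
    move=> l; apply: contraNeq => il; rewrite !mxE (_ : (i == l) = false); last first.
      by apply: contraNF il => /eqP ->.
    rewrite mulr0n sub0r oppr_eq0 big1 // => r _.
    have [->|Dir] := eqVneq (D i r) 0; first by rewrite mul0r.
    have [_ /(_ l)] := Dr i r dile Dir; rewrite mxE.
    have [->|_ /(_ isT) lr] := eqVneq (H r l) 0; first by rewrite mulr0.
    by rewrite lr (cartan_mx_deg_neq0 Dir) addrK eqxx in il.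
  (* The identity D H + H D = q holds on the rows of degree one higher, and D D = 0; together they
     make the right-hand side a cocycle. *)
  have yD : y *m D = 0.
    have DHD : row i (D *m (H *m D)) = row i (D *m (q%:M - D *m H)).
      rewrite !row_mul !mulmx_sum_row; apply: eq_bigr => r _; rewrite ![row i D 0 r]mxE.
      have [->|Dir] := eqVneq (D i r) 0; first by rewrite !scale0r.
      have [e _] := Dr i r dile Dir; congr (_ *: _).
      by rewrite [RHS]linearB /= -e [row r (_ + _)]linearD /= addrAC subrr add0r.
    rewrite mulmxBl -!row_mul -mulmxA DHD mulmxBr mulmxA cartan_mx_sqr mul0mx subr0.
    by rewrite mul_scalar_mx mul_mx_scalar subrr.
  have [|z zE zj] := cartan_mx_exact _ yj yD; last by exists z => _; rewrite -zE.
  by move=> i'; apply: lex; rewrite lt_neqAle dd degD.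
exists (\matrix_(i < m) if deg i == d0 - s%:Z then z i else row i H) => i di.
set H' := \matrix_(_ < m) _.
have H'E r : row r H' = if deg r == d0 - s%:Z then z r else row r H by rewrite rowK.
have DH' : row i (D *m H') = row i (D *m H).
  rewrite !row_mul !mulmx_sum_row; apply: eq_bigr => r _; rewrite H'E mxE.
  case: eqP => // rs; rewrite cartan_mx_deg ?scale0r //; rewrite rs.
  by apply/eqP; move: di; lia.
rewrite linearD /= DH' [row i (H' *m D)]row_mul H'E.
case: (eqVneq (deg i) (d0 - s%:Z)) => [e|ne].
  by have [-> zj] := zE i e; rewrite addrC subrK.
have [|e Hj] := HE i; first by move: di ne; lia.
by rewrite -row_mul -linearD.
Qed.

Hypothesis Kinf : infinite_set [set: K]%classic.

(** At the point c, D becomes the matrix of v. If v x = 0 modulo N, the homotopy identity gives q(c)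
    x = x H(c) D(c), a multiple of v, and q(c) is invertible. *)
Lemma exists_regular : exists2 v : E, extcomp 1 v = v &
  forall x, v *: x \in N -> exists y, x - v *: y \in N.
Proof.
have [q [H [q0 HE]]] := cartan_mx_homotopy.
have [c qc] := mpoly_nonroot Kinf q0.
pose v := \sum_k (c k)%:A * w k.
have v1 : extcomp 1 v = v.
  rewrite raddf_sum; apply: eq_bigr => k _.
  by rewrite -scalerAl mul1r [LHS]linearZ_LR /= w1.
pose ev p r (X : 'M[S]_(p, r)) := map_mx (meval c) X.
have coZ a x : co (a%:A *: x) = a *: co x.
  by apply: coP; rewrite lincombZ -scalerBr rpredZ.
have evD : ev _ _ D = \sum_k c k *: A k.
  apply/matrixP => i l; rewrite mxE cartan_mxE raddf_sum summxE; apply: eq_bigr => k _.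
  by rewrite /= mevalM mevalXU mevalC [in RHS]mxE.
have cov x : co (v *: x) = co x *m ev _ _ D.
  rewrite evD mulmx_sumr scaler_suml co_sum; apply: eq_bigr => k _.
  by rewrite -scalerA coZ co_mul scalemxAr.
exists v => // x /coN; rewrite cov => xD.
exists ((q.@[c])^-1%:A *: lin (co x *m ev _ _ H)).
apply/co_eq; rewrite scalerA.
have -> : v * (q.@[c])^-1%:A = (q.@[c])^-1%:A * v by rewrite -scalerAl -scalerAr mulr1 mul1r.
rewrite -scalerA coZ cov co_lin -mulmxA.
have : co x *m ev _ _ (D *m H + H *m D) = q.@[c] *: co x.
  by rewrite HE /ev map_scalar_mx mul_mx_scalar.
rewrite /ev in xD *; rewrite map_mxD !map_mxM mulmxDr !mulmxA xD mul0mx add0r => ->.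
by rewrite scalerA mulVf // scale1r.
Qed.

End Polynomials.
End Coordinates.

(** * Regular sequences *)

Section Main.
Variables (K : fieldType) (n : nat).
Local Notation E := (extalg K n).
Local Notation mon := 'X_{1..n}.

Lemma exists_regular_elt (M : gmod K n) (N : submodClosed M) (w : 'I_n -> E) (d0 : int) :
  infinite_set [set: K]%classic -> finite_dim M -> graded_submod N ->
  (forall k, extcomp 1 (w k) = w k) ->
  (forall j x, homogeneous j x -> d0 < j -> x \in N) ->
  (forall i, chain_exact w N i d0) ->
  (forall i j, j < d0 -> cochain_exact w N i j) ->
  exists2 v : E, extcomp 1 v = v & forall x, v *: x \in N -> exists y, x - v *: y \in N.
Proof.
move=> Kinf Mfin gN w1 top rex lex.
have [m [b [deg [bj /choice[co coE] bI]]]] := homog_basis N Mfin.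
exact: (exists_regular gN bj bI coE w1 top rex lex Kinf).
Qed.

(** Steinitz exchange that keeps the vectors marked by Q: v replaces an unmarked vector on which its
    coordinate is nonzero. *)
Lemma basis_exchange (w : 'I_n -> E) (v : E) (Q : pred 'I_n) :
  cartan_basis w -> extcomp 1 v = v ->
  (forall c : 'I_n -> K, v = \sum_k c k *: w k -> exists2 k, ~~ Q k & c k != 0) ->
  exists w', [/\ cartan_basis w', forall k, Q k -> w' k = w k & exists k, w' k = v].
Proof.
move=> wB v1 vQ; have [w1 [G GE]] := wB.
pose c k := \sum_m (v [set m]%SET : K) * G m k.
have [|k1 Qk1 ck1] := vQ c.
  rewrite {1}(deg1_sum v1); under eq_bigr => m _ do rewrite (extgen_basisE w1 GE) scaler_sumr.
  rewrite exchange_big; apply: eq_bigr => k _ /=; rewrite scaler_suml.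
  by apply: eq_bigr => m _; rewrite scalerA.
exists (fun k => if k == k1 then v else w k); split; last by exists k1; rewrite eqxx.
  split=> [k|]; first by case: ifP.
  (* The new dual basis: the coordinate k1 is divided by c_(k1), the others are corrected to vanish
     on v. *)
  exists (fun m l => if l == k1 then (c k1)^-1 * G m k1 else G m l - c l / c k1 * G m k1).
  move=> j l.
  have pairE (u : E) : \sum_m (u [set m]%SET : K) *
      (if l == k1 then (c k1)^-1 * G m k1 else G m l - c l / c k1 * G m k1) =
      if l == k1 then (c k1)^-1 * \sum_m (u [set m]%SET : K) * G m k1
      else \sum_m (u [set m]%SET : K) * G m l - c l / c k1 * \sum_m (u [set m]%SET : K) * G m k1.
    case: ifP => _; rewrite !mulr_sumr -?sumrB; apply: eq_bigr => m _; ring.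
  have [jk|jk] := eqVneq j k1; rewrite pairE.
    rewrite -/(c k1) -/(c l) jk eq_sym; case: eqVneq => [_|kl]; first by rewrite mulVf.
    by rewrite divfK // subrr.
  rewrite !GE; case: eqVneq => [->|lk]; first by rewrite (negPf jk) mulr0.
  by rewrite (negPf jk) mulr0 subr0.
by move=> k Qk; case: eqP => // kk; rewrite -kk Qk in Qk1.
Qed.

Section RegularSequences.
Variable M : gmod K n.

Lemma idealmul_nil (x : M) : x \in idealmul [::] M -> x = 0.
Proof.
elim/gensub_ind => [|_ [v [y []]]] //.
by split=> // a y z -> ->; rewrite scaler0 addr0.
Qed.

(** The multiples v y already form a submodule, because a v = v b for the parity conjugate b of
    a. *)
Lemma idealmul_rcons (vs : seq E) (v : E) (x : M) : extcomp 1 v = v ->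
  x \in idealmul (rcons vs v) M <-> exists y, x - v *: y \in idealmul vs M.
Proof.
move=> v1; split=> [|[y xy]].
  elim/gensub_ind => [|_ [u [y [+ ->]]]].
    split=> [|a x1 x2 [y1 H1] [y2 H2]]; first by exists 0; rewrite scaler0 subrr rpred0.
    have [b bE] := mul_extgen_sign a.
    have avE : a * v = v * b.
      rewrite (deg1_sum v1) mulr_sumr mulr_suml; apply: eq_bigr => l _.
      by rewrite -scalerAr -scalerAl bE.
    exists (b *: y1 + y2).
    rewrite scalerDr scalerA -avE -scalerA opprD addrACA -scalerBr rpredD //.
    exact: rpredZ.
  rewrite mem_rcons inE => /predU1P[->|uvs]; first by exists y; rewrite subrr rpred0.
  by exists 0; rewrite scaler0 subr0; apply: gensub_sub; exists u, y.
have sub z : z \in idealmul vs M -> z \in idealmul (rcons vs v) M.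
  elim/gensub_ind => [|_ [u [z' [uvs ->]]]].
    by split=> [|a z1 z2 H1 H2]; [rewrite rpred0 | rewrite rpredD // rpredZ].
  by apply: gensub_sub; exists u, z'; rewrite mem_rcons inE uvs orbT.
rewrite -(subrK (v *: y) x) rpredD //; first exact: sub.
by apply: gensub_sub; exists v, y; rewrite mem_rcons mem_head.
Qed.

Lemma idealmul_graded (vs : seq E) : (forall v, v \in vs -> extcomp 1 v = v) ->
  graded_submod (idealmul vs M).
Proof.
elim/last_ind: vs => [_ j x /idealmul_nil ->|vs v IH vs1 j x]; first by rewrite gcomp0 rpred0.
have v1 : extcomp 1 v = v by apply: vs1; rewrite mem_rcons mem_head.
move=> /(idealmul_rcons _ _ v1)[y xy]; apply/idealmul_rcons => //.
exists (gcomp (j - 1) y); rewrite -gcompZ1 // -gcompB; apply: IH => // u uvs.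
by apply: vs1; rewrite mem_rcons inE uvs orbT.
Qed.

Lemma qproj_eq0 (N : submodClosed M) x : qproj N x = 0 <-> x \in N.
Proof. by rewrite -(raddf0 (qproj N)) qprojE subr0. Qed.

Lemma regular_eltE (N : submodClosed M) v : regular_elt (quotmod N) v <->
  forall x : M, v *: x \in N <-> exists y, x - v *: y \in N.
Proof.
have HE x : (exists y : quotmod N, qproj N x = v *: y) <-> exists y, x - v *: y \in N.
  split=> [[y]|[y /qprojE xy]].
    by rewrite -(qprojP y) -linearZ => /qprojE; exists (repr y).
  by exists (qproj N y); rewrite xy linearZ.
split=> [reg x|H x]; first by rewrite -qproj_eq0 linearZ reg HE.
by rewrite -(qprojP x) -linearZ qproj_eq0 H HE.
Qed.

Section Sequence.
Variable vs : seq E.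
Hypothesis vs_reg : regular_seq M vs.
Local Notation Nk k := (idealmul (take k vs) M).

Lemma regular_seq_deg1 k : (k < size vs)%N -> extcomp 1 vs`_k = vs`_k.
Proof. by case: vs_reg => + _ _ => vs1 kt; apply: vs1; apply: mem_nth. Qed.

Lemma regular_seq_graded k : graded_submod (Nk k).
Proof. by case: vs_reg => vs1 _ _; apply: idealmul_graded => v /mem_take; apply: vs1. Qed.

Lemma regular_seq_step k : (k < size vs)%N -> regular_step (Nk k) (Nk k.+1) vs`_k.
Proof.
move=> kt; rewrite (take_nth 0 kt); split=> x.
  by apply: idealmul_rcons; apply: regular_seq_deg1.
rewrite idealmul_rcons; last exact: regular_seq_deg1.
by case: vs_reg => _ /(_ k kt)/regular_eltE.
Qed.

Variable d : int.
Hypothesis top : forall j (x : M), homogeneous j x -> d < j -> x = 0.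

(** If j exceeds d - k - 1, then v x has degree above d - k and vanishes modulo the first k
    elements; regularity puts x into the next submodule. *)
Lemma regular_seq_top k j (x : M) : (k <= size vs)%N -> homogeneous j x -> d - k%:Z < j ->
  x \in Nk k.
Proof.
elim: k j x => [|k IH] j x kt xj dj.
  by rewrite (top xj) ?rpred0 //; move: dj; rewrite subr0.
apply/(regular_seq_step kt).2; apply: (IH (j + 1)); first exact: ltnW.
  by apply: homogZ1' => //; apply: regular_seq_deg1.
by move: dj; lia.
Qed.

Variable x0 : M.
Hypotheses (x00 : homogeneous 0 x0) (x0_neq0 : x0 != 0).
Hypothesis neg : forall x : M, gcomp (-1) x = 0.

(** Products of a degree 1 element that land in degree 0 come from M_(-1) = 0. So x0 survives in
    every such quotient, which is therefore nonzero. *)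
Lemma idealmul_degree0 (us : seq E) : (forall v, v \in us -> extcomp 1 v = v) ->
  x0 \notin idealmul us M.
Proof.
move=> us1; suff H x : x \in idealmul us M -> gcomp 0 x = 0.
  by apply/negP => /H; rewrite x00; apply/eqP.
elim/last_ind: us us1 x => [_ x /idealmul_nil ->|us v IH us1 x]; first exact: gcomp0.
have v1 : extcomp 1 v = v by apply: us1; rewrite mem_rcons mem_head.
move=> /(idealmul_rcons _ _ v1)[y /IH]; rewrite gcompB gcompZ1 // sub0r neg scaler0 subr0.
by apply=> u uus; apply: us1; rewrite mem_rcons inE uus orbT.
Qed.

Lemma regular_seq_basis k : (k <= size vs)%N ->
  exists2 w, cartan_basis w & forall i, (i < k)%N -> exists k0, w k0 = vs`_i.
Proof.
elim: k => [|k IH] kt; first by exists (@extgen K n) => //; exact: cartan_basis_extgen.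
have [w wB wE] := IH (ltnW kt).
have [c cE|w' [w'B w'Q w'v]] := basis_exchange (Q := fun l => w l \in take k vs) wB
  (regular_seq_deg1 kt).
  (* If the new element were a combination of the earlier ones, it would annihilate the current
     quotient. Regularity would then make that quotient zero, contradicting the survival of x0. *)
  apply: contrapT => nk.
  have vN (x : M) : vs`_k *: x \in Nk k.
    rewrite cE scaler_suml; apply: rpred_sum => l _.
    have [wl|wl] := boolP (w l \in take k vs).
      rewrite -[w l]mul1r scalerAl -scalerA rpredZ //.
      by apply: gensub_sub; exists (w l), x.
    have [->|cl] := eqVneq (c l) 0; first by rewrite !scale0r rpred0.
    by case: nk; exists l.
  have x0N : x0 \in Nk k.
    have /(regular_seq_step kt).2/(regular_seq_step kt).1[y xy] := vN x0.
    by rewrite -(subrK (vs`_k *: y) x0) rpredD.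
  suff /negP : x0 \notin Nk k by apply.
  by apply: idealmul_degree0 => v /mem_take; case: vs_reg => vs1 _ _; apply: vs1.
exists w' => // i; rewrite ltnS leq_eqVlt => /predU1P[->//|ik].
have [k0 k0E] := wE i ik; exists k0; rewrite w'Q // k0E -(nth_take 0 ik) mem_nth //.
by rewrite size_takel // ltnW.
Qed.

(** In M-degrees above d - t the quotient by the whole sequence is zero, hence exact. Exactness is
    then lifted back to M through the sequence, in a basis containing it. *)
Lemma regular_seq_chain_exact : exists2 w, cartan_basis w &
  forall i j, d - (size vs)%:Z < j -> chain_exact w (pred1 (0 : M)) i j.
Proof.
have [w wB wE] := regular_seq_basis (leqnn _); exists w => // i j dj.
have H k : (k <= size vs)%N -> chain_exact w (Nk (size vs - k)) i j.
  elim: k => [_|k IH kt].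
    move=> g gj _; exists (fun=> 0) => [a|a _]; first exact: homog0.
    by rewrite submodB ?chd_sub ?subn0 //; [exact: (regular_seq_top _ (gj a)) | move=> *;
      exact: rpred0].
  have kt' : (size vs - k.+1 < size vs)%N by rewrite ltn_subrL (leq_ltn_trans _ kt).
  have [k0 k0E] := wE _ kt'.
  apply: (chain_exact_lift wB.1 (regular_seq_deg1 kt') (@regular_seq_graded _) (regular_seq_step
    kt') k0E).
  by rewrite subnSK //; apply: IH; apply: ltnW.
have := H (size vs) (leqnn _); rewrite subnn take0 => ex g gj gc.
have [b bi|h hj hE] := ex g gj; first by have := gc b bi; rewrite inE => /eqP ->; exact: rpred0.
by exists h => // a /hE/idealmul_nil ->; rewrite inE.
Qed.

(** For a longer sequence M-degree 0 would be exact, making x0 a boundary of elements of degree -1,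
    which are zero. *)
Lemma regular_seq_size_le : (size vs)%:Z <= d.
Proof.
rewrite leNgt; apply/negP => dt; have [w wB ex] := regular_seq_chain_exact.
have [|a|b //|h hj hE] := ex 0%N 0 _ (fun=> x0); first by move: dt; lia.
- by [].
have := hE 0%MM mdeg0; rewrite inE [chd _ _ _]big1 ?subr0 => [|k _]; first by apply/negP.
by rewrite -(hj _) sub0r neg scaler0.
Qed.

Hypothesis Kinf : infinite_set [set: K]%classic.
Hypothesis Mfin : finite_dim M.
Hypothesis lex : forall i j, j < d -> cochain_exact (@extgen K n) (pred1 (0 : M)) i j.
Hypothesis rex : forall i, chain_exact (@extgen K n) (pred1 (0 : M)) i (d - (size vs)%:Z).

Lemma regular_seq_extend : exists v, regular_seq M (rcons vs v).
Proof.
have w1 := (cartan_basis_extgen K n).1.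
(* For D the M-degree stays d - t along the whole sequence; for S, below, the range of exactness
   shrinks by one at each step and meets it at the end. *)
have rexk k : (k <= size vs)%N -> forall i, chain_exact (@extgen K n) (Nk k) i (d - (size vs)%:Z).
  elim: k => [_ i|k IH kt i].
    rewrite take0 => g gj gc; have [b bi|h hj hE] := @rex i g gj.
      by rewrite inE; apply/eqP/idealmul_nil/gc.
    by exists h => // a /hE; rewrite inE => /eqP ->; exact: rpred0.
  exact: (chain_exact_step w1 (regular_seq_deg1 kt) (@regular_seq_graded _) (regular_seq_step kt)
    (IH (ltnW kt))).
have lexk k : (k <= size vs)%N -> forall i j, j < d - k%:Z -> cochain_exact (@extgen K n) (Nk k)
  i j.
  elim: k => [_ i j jd|k IH kt i j jd].
    rewrite take0 => g gj gc; rewrite subr0 in jd; have [b bi|h hj hE] := @lex i j jd g gj.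
      by rewrite inE; apply/eqP/idealmul_nil/gc.
    by exists h => // a /hE; rewrite inE => /eqP ->; exact: rpred0.
  apply: (cochain_exact_step w1 (regular_seq_deg1 kt) (@regular_seq_graded _) (regular_seq_step
    kt)) => i'.
  by apply: IH; [exact: ltnW | move: jd; lia].
have [|v v1 vreg] := exists_regular_elt Kinf Mfin (@regular_seq_graded (size vs)) w1 _
  (rexk _ (leqnn _)) (lexk _ (leqnn _)).
  by move=> j x xj; apply: regular_seq_top.
rewrite take_size in vreg.
have [vs1 reg _] := vs_reg.
have rc1 u : u \in rcons vs v -> extcomp 1 u = u.
  by rewrite mem_rcons inE => /predU1P[->//|]; apply: vs1.
exists v; split=> //.
  move=> k; rewrite size_rcons ltnS leq_eqVlt => /predU1P[->|kt].
    rewrite -cats1 take_size_cat // nth_cat ltnn subnn /=; apply/regular_eltE => x.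
    split; first exact: vreg.
    move=> [y xy]; have -> : v *: x = v *: (x - v *: y).
      by rewrite scalerBr scalerA deg1_sqr // scale0r subr0.
    exact: rpredZ.
  by rewrite nth_rcons kt -cats1 takel_cat ?(ltnW kt) //; apply: reg.
exists (qproj _ x0); apply/eqP => /qproj_eq0; apply/negP; exact: idealmul_degree0.
Qed.

End Sequence.
End RegularSequences.
End Main.

Theorem theorem5p3 (K : fieldType) (n : nat) (d : int)
    (J : submodClosed (extalg K n)^o) (HJ : graded_ideal J) :
  infinite_set [set: K]%classic ->
  (1 : extalg K n) \notin J ->
  linear_inj_resolution (idealquot HJ) d ->
  exists (r : int) (t : nat),
    [/\ is_reg (idealquot HJ) r, is_depth (idealquot HJ) t & r + t%:Z = d].
Proof.
move=> Kinf J1 [mu [R]].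
set M := idealquot HJ.
pose x0 : M := qproj J (1 : (extalg K n)^o).
have compE j (x : (extalg K n)^o) : gcomp j (qproj J x : M) = qproj J (extcomp j x).
  exact: (quotcompE (proj1 HJ)).
have x00 : homogeneous 0 x0.
  rewrite /Defs.homog compE; congr (qproj J _).
  by have := @extcomp0_scal K n 1; rewrite scale1r.
have x0_neq0 : x0 != 0.
  by apply/eqP => /(@qproj_eq0 K n (gself K n)); apply/negP.
have neg (x : M) : gcomp (-1) x = 0.
  have ext0 (y : extalg K n) : extcomp (-1) y = 0 by apply/ffunP => A; rewrite !ffunE.
  by rewrite -(qprojP x) compE ext0; exact: raddf0.
have Mfin : finite_dim M.
  pose x_ A : M := qproj J (extmon K A : (extalg K n)^o).
  exists {set 'I_n}, (fun A : {set 'I_n} => x_ A), (fun A : {set 'I_n} => #|A|%:Z); split=> [A|x].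
    by rewrite /Defs.homog compE extmon_deg.
  exists (repr x : extalg K n); rewrite -{1}(qprojP x) {1}[repr x](extalg_monE (repr x)).
  by rewrite raddf_sum; apply: eq_bigr => A _; rewrite -linearZ.
have top j (x : M) : homogeneous j x -> d < j -> x = 0 := @ir_gt_d K n M d mu R j x.
have lex i j : j < d -> cochain_exact (@extgen K n) (pred1 (0 : M)) i j :=
  @linear_cochain_exact K n M d mu R i j.
have [F] := free_resolution_exists Mfin.
have bound vs : regular_seq M vs -> forall i j, Tor_neq0 F i j -> j - i%:Z <= d - (size vs)%:Z.
  move=> vs_reg i j T; have [w wB ex] := regular_seq_chain_exact vs_reg top x00 x0_neq0 neg.
  rewrite leNgt; apply/negP => /(ex i)/(chain_exact_Tor wB F).
  by rewrite subrK.
have attained vs : max_regular_seq M vs -> exists i j, Tor_neq0 F i j /\ j - i%:Z = d - (size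
  vs)%:Z.
  move=> [vs_reg vs_max]; apply: contrapT => nT.
  have [|v] := regular_seq_extend vs_reg top x00 x0_neq0 neg Kinf Mfin lex; last exact: vs_max.
  move=> i; apply/(chain_exact_Tor (cartan_basis_extgen K n) F) => T.
  by apply: nT; exists i, (d - (size vs)%:Z + i%:Z); rewrite addrK.
(* The lengths of regular sequences are bounded by d, so a longest one exists and is maximal. *)
have [vs vs_max] : exists vs, max_regular_seq M vs.
  pose P t := `[< exists2 vs, regular_seq M vs & size vs = t >].
  have exP : exists t, P t.
    exists 0%N; apply/asboolP; exists [::] => //; split=> //.
    by exists (qproj _ x0); apply/eqP => /qproj_eq0/idealmul_nil/eqP; apply/negP.
  have Pd t : P t -> (t <= `|d|)%N.
    move=> /asboolP[vs /regular_seq_size_le-/(_ d top x0 x00 x0_neq0 neg) + <-].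
    by lia.
  have [t /asboolP[vs vs_reg vst] tmax] := ex_maxnP exP Pd.
  exists vs; split=> // v v_reg.
  have /tmax : P t.+1 by apply/asboolP; exists (rcons vs v); rewrite // size_rcons vst.
  by rewrite ltnn.
exists (d - (size vs)%:Z), (size vs); split; last by rewrite subrK.
  by exists F; split; [exact: attained | exact: (bound _ vs_max.1)].
split=> [|vs' vs'_max]; first by exists vs.
(* Each of d - |vs| and d - |vs'| is attained by Tor and bounds it, so the two lengths agree. *)
have [i [j [T e]]] := attained _ vs_max; have [i' [j' [T' e']]] := attained _ vs'_max.
have := bound _ vs_max.1 _ _ T'; have := bound _ vs'_max.1 _ _ T.
by rewrite e e'; lia.
Qed.
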